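(* Fix an even integer $r\ge 2$. Let $X\subset \mathbb{P}^r$ be an integral and non-degenerate curve. There is a non-empty open subset $\mathcal{U}\subset \mathbb{P}^r$ such that $r_X(q)=r/2+1$ for all $q\in\mathcal{U}$ and the following properties hold: (a) We have $\{q\}=\bigcap_{S\in\mathcal{S}(X,q)}\langle S\rangle$ for all $q\in\mathcal{U}$. (b) For all $(q,q')\in\mathcal{U}\times\mathbb{P}^r$, if $\mathcal{S}(X,q')=\mathcal{S}(X,q)$, then $q'=q$.
   Context: Open means open in the Zariski topology. For a set $A\subset\mathbb{P}^r$, $\langle A\rangle$ denotes its linear span. A subvariety $X\subset\mathbb{P}^r$ is non-degenerate if it is not contained in any hyperplane. For an integral and non-degenerate variety $X\subset\mathbb{P}^r$ and $q\in\mathbb{P}^r$, the $X$-rank $r_X(q)$ is the minimal cardinality of a finite set $S\subset X$ such that $q\in\langle S\rangle$, and $\mathcal{S}(X,q)$ is the set of all $S\subset X$ such that $|S|=r_X(q)$ and $q\in\langle S\rangle$. *)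

(* Defs.v *)
From HB Require Import structures.
From mathcomp Require Import all_boot all_order all_algebra finmap.
From mathcomp Require Import boolp classical_sets.
From mathcomp Require Import mpoly.

Set Implicit Arguments.
Unset Strict Implicit.
Unset Printing Implicit Defensive.

Import GRing.Theory.
Local Open Scope ring_scope.
Local Open Scope classical_set_scope.

(* A point of P^r is a line through the origin of K^(r+1); subspaces are
   canonically represented, so equality of points is Leibniz equality. *)
Definition pspace (K : fieldType) (r : nat) : Type :=
  {L : {vspace 'rV[K]_r.+1} | \dim L == 1%N}.

HB.instance Definition _ (K : fieldType) (r : nat) := Choice.on (pspace K r).

Section ProjectiveGeometry.
Variables (K : fieldType) (r : nat).
Local Notation P := (pspace K r).

(* The linear subspace of P^r attached to a vector subspace V of K^(r+1); its
   projective dimension is (\dim V).-1. *)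
Definition plin (V : {vspace 'rV[K]_r.+1}) : set P :=
  [set p | (val p <= V)%VS].

Definition pspan (A : set P) : set P :=
  \bigcap_(V in [set V | A `<=` plin V]) plin V.

Definition nondegenerate_set (X : set P) : Prop :=
  forall H : {vspace 'rV[K]_r.+1}, \dim H = r -> ~ X `<=` plin H.

(* Only used for homogeneous f, where testing all the vectors of the line p
   amounts to testing one nonzero representative. *)
Definition vanishes_at (f : {mpoly K[r.+1]}) (p : P) : Prop :=
  forall v : 'rV[K]_r.+1, v \in val p -> f.@[v 0] = 0.

Definition zariski_closed (Z : set P) : Prop :=
  exists F : set {mpoly K[r.+1]},
    (forall f, F f -> exists d : nat, f \is d.-homog) /\
    Z = [set p | forall f, F f -> vanishes_at f p].

Definition zariski_open (U : set P) : Prop := zariski_closed (~` U).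

Definition irreducible_set (Z : set P) : Prop :=
  Z !=set0 /\
  forall A B : set P, zariski_closed A -> zariski_closed B ->
    Z `<=` A `|` B -> Z `<=` A \/ Z `<=` B.

(* A strictly increasing chain C 0, ..., C n of irreducible closed subsets of
   Z; the values of C beyond n are irrelevant. *)
Definition irr_chain (Z : set P) (n : nat) (C : nat -> set P) : Prop :=
  (forall i, (i <= n)%N ->
     [/\ zariski_closed (C i), irreducible_set (C i) & C i `<=` Z]) /\
  (forall i, (i < n)%N -> C i `<` C i.+1).

(* Chains can be truncated, so the second clause excludes all longer chains. *)
Definition krull_dim (Z : set P) (n : nat) : Prop :=
  (exists C, irr_chain Z n C) /\ ~ (exists C, irr_chain Z n.+1 C).

(* Over an algebraically closed field, the integral closed subschemes of P^r
   correspond to the irreducible closed sets of points. *)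
Definition integral_curve (X : set P) : Prop :=
  [/\ zariski_closed X, irreducible_set X & krull_dim X 1].

Definition spanning_set (X : set P) (q : P) (S : {fset P}) : Prop :=
  [set` S] `<=` X /\ pspan [set` S] q.

Definition is_Xrank (X : set P) (q : P) (n : nat) : Prop :=
  (exists2 S, spanning_set X q S & #|` S| = n) /\
  (forall S, spanning_set X q S -> (n <= #|` S|)%N).

(* The default value 0 is taken only when no finite subset of X spans q. *)
Definition Xrank (X : set P) (q : P) : nat := xget 0%N (is_Xrank X q).

Definition solutions (X : set P) (q : P) : set {fset P} :=
  [set S | spanning_set X q S /\ #|` S| = Xrank X q].

End ProjectiveGeometry.

(* Main.v *)
Require Import Defs.
From HB Require Import structures.
From mathcomp Require Import all_boot all_order all_algebra finmap.
From mathcomp Require Import boolp classical_sets.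
From mathcomp Require Import closed_field zify ring mpoly.

Set Implicit Arguments.
Unset Strict Implicit.
Unset Printing Implicit Defensive.

Import Order.TTheory GRing.Theory.
Local Open Scope ring_scope.
Local Open Scope classical_set_scope.

(* Write r = 2k, V = K^(r+1), and let C be the affine cone of X. The sums of k
   elements of C depend on 2k parameters, so they are not dense in V. The dense
   set of sums is reached one step later: if x in C does not stabilize the closure
   of kC, then kC + Kx is dense, because the irreducible sets
   0 < Kx_1 < C < C + Kx_2 < 2C < ... < kC < kC + Kx
   form a strict chain whose length is already dim V (a set stabilized by all of C
   would be V, as C spans V). Fix two independent such x and y. A general q lies in
   spans <x, T> and <y, T'> with k points in each of T and T'; counting parameters,
   with the finiteness of the hyperplane sections of X, the q for which
   <x, T> + <y, T'> is not V depend on at most 2k parameters. For the other q these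
   two spans meet exactly in q, so two decompositions already determine q.

   Dimensions are measured by the growth of the spaces of polynomial functions,
   which needs neither irreducible components nor generic points. Quantifier
   elimination over K makes the image of a constructible set constructible: a dense
   image contains a non-empty open set, and a coordinate with finite fibres is
   algebraic over the others. *)

(** * Polynomial functions and constructible conditions *)

(** Sums of k+1 elements of C have 2k+2 parameters, one more than dim V, so a general q has a
    one-parameter family of decompositions. Prescribing one point uses up this excess, and
    prescribing two different points x and y selects two decompositions. Outside kC the rank is at
    least k+1, so both belong to S(X,q). Their spans have dimension at most k+1 and fill a space of
    dimension 2k+1, so they share only the line of q. Property (b) is then formal: q' lies in every
    span attached to S(X,q') = S(X,q).

    The chain of irreducible sets stands in for tangent spaces, so the characteristic is arbitrary.
    Closed sets are given by arbitrary families of forms; Hilbert's basis theorem makes them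
    constructible, and it provides an irreducible closed set inside an infinite hyperplane section,
    which would make a chain in X too long. The polynomial that excludes the exceptional vectors of
    V need not be homogeneous; one of its homogeneous components defines the open subset of the
    projective space. *)

Section Polynomials.
Variable K : fieldType.

(** Functions on a bare set [Om] rather than formal polynomials: [Om] will also be a set of
    decompositions, where only values matter. The index is an upper bound for the degree. *)
Inductive pol (Om : Type) (G : set (Om -> K)) : nat -> (Om -> K) -> Prop :=
| PolConst d c : pol G d (fun=> c)
| PolGen d g : G g -> pol G d.+1 g
| PolAdd d p q : pol G d p -> pol G d q -> pol G d (fun w => p w + q w)
| PolMul d e p q :
    pol G d p -> pol G e q -> pol G (d + e) (fun w => p w * q w).

Definition alg (Om : Type) (G : set (Om -> K)) (p : Om -> K) : Prop :=
  exists d, pol G d p.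

Inductive constr (Om : Type) (G : set (Om -> K)) : (Om -> Prop) -> Prop :=
| ConstrZero p : alg G p -> constr G (fun w => p w = 0)
| ConstrAnd P Q : constr G P -> constr G Q -> constr G (fun w => P w /\ Q w)
| ConstrNot P : constr G P -> constr G (fun w => ~ P w).

Definition coords (Om : Type) (n : nat) (t : Om -> 'rV[K]_n) : set (Om -> K) :=
  [set c | exists j, c = fun w => t w 0 j].

Definition pull (Om Om' : Type) (f : Om' -> Om) (G : set (Om -> K)) :
  set (Om' -> K) := [set c | exists2 g, G g & c = g \o f].

Section Closure.
Variables (Om : Type) (G : set (Om -> K)).

Lemma pol_leq d e p : (d <= e)%N -> pol G d p -> pol G e p.
Proof.
move=> + pd; elim: pd e => {d p}.
- by move=> d c e _; apply: PolConst.
- by move=> d g Gg [//|e] _; apply: PolGen.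
- by move=> d p q _ IHp _ IHq e de; apply: PolAdd; [apply: IHp|apply: IHq].
- move=> d d' p q _ IHp _ IHq e de.
  have -> : e = (d + (e - d))%N by lia.
  by apply: PolMul; [apply: IHp|apply: IHq; lia].
Qed.

Lemma alg_const c : alg G (fun=> c).
Proof. by exists 0%N; apply: PolConst. Qed.

Lemma alg_gen g : G g -> alg G g.
Proof. by move=> Gg; exists 1%N; apply: PolGen. Qed.

Lemma alg_add p q : alg G p -> alg G q -> alg G (fun w => p w + q w).
Proof.
move=> [d pd] [e qe]; exists (maxn d e).
by apply: PolAdd; [apply: pol_leq pd|apply: pol_leq qe]; lia.
Qed.

Lemma alg_mul p q : alg G p -> alg G q -> alg G (fun w => p w * q w).
Proof. by move=> [d pd] [e qe]; exists (d + e)%N; apply: PolMul. Qed.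

Lemma alg_opp p : alg G p -> alg G (fun w => - p w).
Proof.
move=> ap; rewrite (_ : (fun w => _) = fun w => -1 * p w).
  by apply: alg_mul => //; apply: alg_const.
by apply/funext => w; rewrite mulN1r.
Qed.

Lemma alg_sub p q : alg G p -> alg G q -> alg G (fun w => p w - q w).
Proof. by move=> ap aq; apply: alg_add => //; apply: alg_opp. Qed.

Lemma alg_exp p k : alg G p -> alg G (fun w => p w ^+ k).
Proof.
move=> ap; elim: k => [|k IH]; first by apply: alg_const.
rewrite (_ : (fun w => _) = fun w => p w * p w ^+ k); first exact: alg_mul.
by apply/funext => w; rewrite exprS.
Qed.

Lemma alg_sum (I : Type) (s : seq I) (P : pred I) (F : I -> Om -> K) :
  (forall i, alg G (F i)) -> alg G (fun w => \sum_(i <- s | P i) F i w).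
Proof.
move=> aF; elim: s => [|i s IH].
  rewrite (_ : (fun w => _) = fun=> 0); first exact: alg_const.
  by apply/funext => w; rewrite big_nil.
rewrite (_ : (fun w => _) =
  fun w => (if P i then F i w else 0) + \sum_(i <- s | P i) F i w).
  by apply: alg_add => //; case: (P i) => //; apply: alg_const.
by apply/funext => w; rewrite big_cons; case: ifP; rewrite ?add0r.
Qed.

Lemma alg_prod (I : Type) (s : seq I) (P : pred I) (F : I -> Om -> K) :
  (forall i, alg G (F i)) -> alg G (fun w => \prod_(i <- s | P i) F i w).
Proof.
move=> aF; elim: s => [|i s IH].
  rewrite (_ : (fun w => _) = fun=> 1); first exact: alg_const.
  by apply/funext => w; rewrite big_nil.
rewrite (_ : (fun w => _) =
  fun w => (if P i then F i w else 1) * \prod_(i <- s | P i) F i w).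
  by apply: alg_mul => //; case: (P i) => //; apply: alg_const.
by apply/funext => w; rewrite big_cons; case: ifP; rewrite ?mul1r.
Qed.

Lemma alg_ext p q : p =1 q -> alg G p -> alg G q.
Proof. by move=> /funext->. Qed.

Lemma constr_ext P Q : (forall w, P w <-> Q w) -> constr G P -> constr G Q.
Proof. by move=> PQ; rewrite (_ : P = Q) //; apply/funext => w; apply/propext. Qed.

Lemma constr_eq p q : alg G p -> alg G q -> constr G (fun w => p w = q w).
Proof.
move=> ap aq; apply: (@constr_ext (fun w => p w - q w = 0)).
  move=> w; split=> [/eqP|->]; last by rewrite subrr.
  by rewrite subr_eq0 => /eqP.
by apply: ConstrZero; apply: alg_sub.
Qed.

Lemma constr_const (P : Prop) : constr G (fun=> P).
Proof.
have [p|np] := pselect P.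
  apply: (@constr_ext (fun=> (0 : K) = 0)) => //.
  by apply: ConstrZero; apply: alg_const.
apply: (@constr_ext (fun=> (1 : K) = 0)) => //.
  by move=> _; split=> // /eqP; rewrite oner_eq0.
by apply: ConstrZero; apply: alg_const.
Qed.

Lemma constr_or P Q : constr G P -> constr G Q -> constr G (fun w => P w \/ Q w).
Proof.
move=> cP cQ; apply: (@constr_ext (fun w => ~ (~ P w /\ ~ Q w))).
  move=> w; split; last by tauto.
  by move=> h; apply: contrapT => h'; apply: h; split; tauto.
by apply: ConstrNot; apply: ConstrAnd; apply: ConstrNot.
Qed.

Lemma constr_forall_seq (I : eqType) (s : seq I) (P : I -> Om -> Prop) :
  (forall i, i \in s -> constr G (P i)) ->
  constr G (fun w => forall i, i \in s -> P i w).
Proof.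
elim: s => [|i s IH] cP.
  by apply: (@constr_ext (fun=> True)) => //; apply: constr_const.
apply: (@constr_ext (fun w => P i w /\ forall i, i \in s -> P i w)).
  move=> w; split=> [[h1 h2] j|h].
    by rewrite inE => /orP[/eqP->|/h2].
  by split=> [|j js]; apply: h; rewrite inE ?eqxx ?js ?orbT.
apply: ConstrAnd; first by apply: cP; rewrite inE eqxx.
by apply: IH => j js; apply: cP; rewrite inE js orbT.
Qed.

Lemma constr_forall (I : finType) (P : I -> Om -> Prop) :
  (forall i, constr G (P i)) -> constr G (fun w => forall i, P i w).
Proof.
move=> cP; apply: (@constr_ext (fun w => forall i, i \in enum I -> P i w)).
  by move=> w; split=> h i; [apply: h; rewrite mem_enum|move=> _; apply: h].
exact: constr_forall_seq.
Qed.

Lemma constr_exists (I : finType) (P : I -> Om -> Prop) :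
  (forall i, constr G (P i)) -> constr G (fun w => exists i, P i w).
Proof.
move=> cP; apply: (@constr_ext (fun w => ~ forall i, ~ P i w)).
  by move=> w; split=> [/existsNP[i /contrapT h]|[i h] h']; [exists i|exact: h' h].
by apply/ConstrNot/constr_forall => i; apply: ConstrNot.
Qed.

Lemma alg_coord n (t : Om -> 'rV[K]_n) j :
  coords t `<=` G -> alg G (fun w => t w 0 j).
Proof. by move=> tG; apply/alg_gen/tG; exists j. Qed.

Lemma constr_eq_row n (t u : Om -> 'rV[K]_n) :
  (forall j, alg G (fun w => t w 0 j)) -> (forall j, alg G (fun w => u w 0 j)) ->
  constr G (fun w => t w = u w).
Proof.
move=> at_ au; apply: (@constr_ext (fun w => forall j, t w 0 j = u w 0 j)).
  by move=> w; split=> [h|-> //]; apply/rowP.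
by apply: constr_forall => j; apply: constr_eq.
Qed.

End Closure.

Lemma pol_trans (Om : Type) (G G' : set (Om -> K)) e :
  (forall g, G' g -> pol G e g) -> forall d p, pol G' d p -> pol G (d * e) p.
Proof.
move=> G'G d p; elim=> {d p}.
- by move=> d c; apply: PolConst.
- by move=> d g /G'G; apply: pol_leq; rewrite leq_pmull.
- by move=> *; apply: PolAdd.
- by move=> *; rewrite mulnDl; apply: PolMul.
Qed.

Lemma pol_pull (Om Om' : Type) (f : Om' -> Om) (G : set (Om -> K)) d p :
  pol G d p -> pol (pull f G) d (p \o f).
Proof.
elim=> {d p}.
- by move=> d c; apply: PolConst.
- by move=> d g Gg; apply: PolGen; exists g.
- by move=> d p q _ IHp _ IHq; apply: PolAdd IHp IHq.
- by move=> d e p q _ IHp _ IHq; apply: PolMul IHp IHq.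
Qed.

Lemma alg_trans (Om : Type) (G G' : set (Om -> K)) :
  (forall g, G' g -> alg G g) -> forall p, alg G' p -> alg G p.
Proof.
move=> G'G p [d]; elim=> {d p}.
- by move=> d c; apply: alg_const.
- by move=> d g /G'G.
- by move=> *; apply: alg_add.
- by move=> *; apply: alg_mul.
Qed.

Lemma alg_subset (Om : Type) (G G' : set (Om -> K)) p :
  G' `<=` G -> alg G' p -> alg G p.
Proof. by move=> G'G; apply: alg_trans => g /G'G; apply: alg_gen. Qed.

Lemma alg_comp (Om Om' : Type) (f : Om' -> Om) (G : set (Om -> K)) G' p :
  (forall g, G g -> alg G' (g \o f)) -> alg G p -> alg G' (p \o f).
Proof.
move=> GG' [d /(pol_pull f) pd]; apply: (@alg_trans _ _ (pull f G)).
  by move=> _ [g Gg ->]; apply: GG'.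
by exists d.
Qed.

Lemma constr_comp (Om Om' : Type) (f : Om' -> Om) (G : set (Om -> K)) G' P :
  (forall g, G g -> alg G' (g \o f)) -> constr G P -> constr G' (P \o f).
Proof.
move=> GG'; elim=> {P}.
- by move=> p ap; apply: ConstrZero; apply: alg_comp ap.
- by move=> P Q _ IHP _ IHQ; apply: ConstrAnd.
- by move=> P _ IHP; apply: ConstrNot.
Qed.

Lemma constr_subset (Om : Type) (G G' : set (Om -> K)) P :
  G' `<=` G -> constr G' P -> constr G P.
Proof.
by move=> G'G; apply: (@constr_comp _ _ id) => g /G'G; apply: alg_gen.
Qed.

(** Truth depends only on which of finitely many polynomials vanish. Finite fibres and dense
    constructible sets are both handled through these vanishing patterns. *)
Lemma constr_pattern (Om : Type) (G : set (Om -> K)) P : constr G P ->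
  exists ps : seq (Om -> K), (forall p, List.In p ps -> alg G p) /\
    forall w w', (forall p, List.In p ps -> p w = 0 <-> p w' = 0) ->
      P w -> P w'.
Proof.
elim=> {P}.
- move=> p ap; exists [:: p]; split=> [q [<-|//]|w w' /(_ p)] //=.
  by case=> [|h _]; [left|].
- move=> P Q _ [ps [aps hP]] _ [qs [aqs hQ]]; exists (ps ++ qs); split.
    by move=> p; rewrite List.in_app_iff => -[/aps|/aqs].
  move=> w w' h [Pw Qw]; split.
    by apply: hP Pw => p ps_p; apply: h; rewrite List.in_app_iff; left.
  by apply: hQ Qw => p ps_p; apply: h; rewrite List.in_app_iff; right.
- move=> P _ [ps [aps hP]]; exists ps; split=> // w w' h nP P'; apply: nP.
  by apply: hP P' => p /h; tauto.
Qed.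

End Polynomials.

(** * Projections of constructible conditions *)

Section Projection.
Variable K : closedFieldType.

Let tF := GRing.term K.
Let fF := GRing.formula K.

Lemma closed_axiom : GRing.closed_field_axiom K.
Proof. by move=> n P; apply: solve_monicpoly. Qed.

Let QE := @GRing.quantifier_elim K (@ClosedFieldQE.ex_elim K).

Lemma QE_holds (e : seq K) f : GRing.rformula f ->
  GRing.holds e (QE f) <-> GRing.holds e f.
Proof.
move=> rf.
have wf := @ClosedFieldQE.wf_ex_elim K.
have hQE := @ClosedFieldQE.holds_ex_elim K closed_axiom.
have /andP[qQ rQ] := GRing.quantifier_elim_wf wf rf.
have h1 := GRing.qf_evalP e qQ.
have h2 := GRing.quantifier_elim_rformP wf hQE e rf.
by split=> [/h1/h2|/h2/h1].
Qed.

Section Reify.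
Variables (Om : Type) (cs : seq (Om -> K)).
Let G := [set c | List.In c cs].
Let env w := [seq c w | c <- cs].

Lemma In_nth_fun c : List.In c cs ->
  exists2 i, (i < size cs)%N & forall w, nth 0 (env w) i = c w.
Proof.
rewrite /env; elim: cs => [//|c' s IH] /= [->|/IH[i lt_i h]]; first by exists 0%N.
by exists i.+1.
Qed.

Lemma alg_reify p : alg G p ->
  exists t : tF, GRing.rterm t /\ forall w, GRing.eval (env w) t = p w.
Proof.
case=> d; elim=> {d p}.
- by move=> _ c; exists (GRing.Const c).
- by move=> _ g /In_nth_fun[i _ h]; exists (GRing.Var _ i).
- move=> d p q _ [t [rt ht]] _ [u [ru hu]]; exists (GRing.Add t u).
  by split=> [|w] /=; rewrite ?rt ?ru ?ht ?hu.
- move=> d e p q _ [t [rt ht]] _ [u [ru hu]]; exists (GRing.Mul t u).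
  by split=> [|w] /=; rewrite ?rt ?ru ?ht ?hu.
Qed.

Lemma constr_reify P : constr G P ->
  exists f : fF, GRing.rformula f /\ forall w, GRing.holds (env w) f <-> P w.
Proof.
elim=> {P}.
- move=> p /alg_reify[t [rt ht]]; exists (GRing.Equal t (GRing.Const 0)).
  by split=> [|w] /=; rewrite ?rt ?ht.
- move=> P Q _ [f [rf hf]] _ [g [rg hg]]; exists (GRing.And f g).
  by split=> [|w] /=; rewrite ?rf ?rg ?hf ?hg.
- move=> P _ [f [rf hf]]; exists (GRing.Not f).
  by split=> [|w] /=; rewrite ?rf ?hf.
Qed.

Lemma term_alg (t : tF) : GRing.rterm t -> alg G (fun w => GRing.eval (env w) t).
Proof.
elim: t => //=.
- move=> i _; have [lt_i|ge_i] := ltnP i (size cs).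
    have -> : (fun w => nth 0 (env w) i) = nth (fun=> 0) cs i.
      by apply/funext => w; rewrite /env (nth_map (fun=> 0)).
    apply: alg_gen; rewrite /G /=; elim: cs i lt_i => [//|c s IH] [|i] /= h.
      by left.
    by right; apply: IH.
  rewrite (_ : (fun w => _) = fun=> 0); first exact: alg_const.
  by apply/funext => w; rewrite nth_default // size_map.
- by move=> c _; apply: alg_const.
- by move=> k _; apply: alg_const.
- by move=> t IHt u IHu /andP[/IHt ht /IHu hu]; apply: alg_add.
- by move=> t IHt /IHt; apply: alg_opp.
- move=> t IHt k /IHt ht.
  rewrite (_ : (fun w => _) = fun w => k%:R * GRing.eval (env w) t).
    by apply: alg_mul => //; apply: alg_const.
  by apply/funext => w; rewrite mulr_natl.
- by move=> t IHt u IHu /andP[/IHt ht /IHu hu]; apply: alg_mul.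
- by move=> t IHt k /IHt; apply: alg_exp.
Qed.

Lemma formula_constr (f : fF) : GRing.qf_form f -> GRing.rformula f ->
  constr G (fun w => GRing.holds (env w) f).
Proof.
elim: f => //=.
- by move=> b _ _; apply: constr_const.
- move=> t u _ /andP[rt ru].
  by apply: constr_eq; apply: term_alg.
- move=> f IHf g IHg /andP[qf qg] /andP[rf rg].
  by apply: ConstrAnd; [apply: IHf|apply: IHg].
- move=> f IHf g IHg /andP[qf qg] /andP[rf rg].
  by apply: constr_or; [apply: IHf|apply: IHg].
- move=> f IHf g IHg /andP[qf qg] /andP[rf rg].
  apply: (@constr_ext _ _ _ (fun w => ~ GRing.holds (env w) f \/
                                        GRing.holds (env w) g)).
    move=> w; split; first by tauto.
    by case: (pselect (GRing.holds (env w) f)); tauto.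
  by apply: constr_or; [apply: ConstrNot; apply: IHf|apply: IHg].
- by move=> f IHf qf rf; apply: ConstrNot; apply: IHf.
Qed.

End Reify.

Lemma alg_list (Om : Type) (G : set (Om -> K)) p : alg G p ->
  exists2 cs, [set c | List.In c cs] `<=` G & alg [set c | List.In c cs] p.
Proof.
case=> d; elim=> {d p}.
- by move=> d c; exists [::] => //; apply: alg_const.
- by move=> d g Gg; exists [:: g]; [move=> _ [<-|//]|apply: alg_gen; left].
- move=> d p q _ [cs cG ap] _ [es eG aq]; exists (cs ++ es).
    by move=> c /=; rewrite List.in_app_iff => -[/cG|/eG].
  by apply: alg_add; [apply: alg_subset ap|apply: alg_subset aq] => c /= h;
    rewrite List.in_app_iff; [left|right].
- move=> d d' p q _ [cs cG ap] _ [es eG aq]; exists (cs ++ es).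
    by move=> c /=; rewrite List.in_app_iff => -[/cG|/eG].
  by apply: alg_mul; [apply: alg_subset ap|apply: alg_subset aq] => c /= h;
    rewrite List.in_app_iff; [left|right].
Qed.

Lemma constr_list (Om : Type) (G : set (Om -> K)) P : constr G P ->
  exists2 cs, [set c | List.In c cs] `<=` G & constr [set c | List.In c cs] P.
Proof.
elim=> {P}.
- by move=> p /alg_list[cs cG ap]; exists cs => //; apply: ConstrZero.
- move=> p q _ [cs cG ap] _ [es eG aq]; exists (cs ++ es).
    by move=> c /=; rewrite List.in_app_iff => -[/cG|/eG].
  by apply: ConstrAnd; [apply: constr_subset ap|apply: constr_subset aq] => c /= h;
    rewrite List.in_app_iff; [left|right].
- by move=> p _ [cs cG ap]; exists cs => //; apply: ConstrNot.
Qed.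

Definition ext (Om : Type) n (G : set (Om -> K)) : set (Om * 'rV[K]_n -> K) :=
  pull fst G `|` coords snd.

Lemma ext_list (Om : Type) n (G : set (Om -> K)) (es : seq (Om * 'rV[K]_n -> K)) :
  [set c | List.In c es] `<=` ext G -> exists2 cs, [set c | List.In c cs] `<=` G &
    [set c | List.In c es] `<=` ext [set c | List.In c cs].
Proof.
elim: es => [|e es IH] eG; first by exists [::].
have /IH[cs cG h] : [set c | List.In c es] `<=` ext G.
  by move=> c /= ec; apply: eG; right.
have [[g Gg eg]|eV] : ext G e by apply: eG; left.
  exists (g :: cs).
    by move=> c /= [<-//|/cG].
  move=> c /= [<-|]; first by left; exists g => //; left.
  by move/h => -[[g' Gg' ->]|cV]; [left; exists g' => //; right|right].
by exists cs => // c /= [<-|/h//]; right.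
Qed.

(** Chevalley's theorem, by quantifier elimination. [G] may be infinite while a formula has finitely
    many variables, so [G] is cut down to a list [cs] of generators that suffices for [P]. *)
Lemma constr_proj (Om : Type) n (G : set (Om -> K))
    (P : Om * 'rV[K]_n -> Prop) : constr (ext G) P ->
  constr G (fun w => exists v, P (w, v)).
Proof.
move=> /constr_list[es /ext_list[cs csG /constr_subset h]] /h{h} cP.
apply: constr_subset csG _.
pose vs : seq (Om * 'rV[K]_n -> K) := 
    [seq (fun wv : Om * 'rV[K]_n => wv.2 0 j) | j <- enum 'I_n].
pose fs := [seq c \o fst | c <- cs] ++ vs.
have /constr_reify[f [rf hf]] : constr [set c | List.In c fs] P.
  apply: constr_subset cP => c [[g gc ->]|[j ->]] /=; rewrite List.in_app_iff.
    by left; apply: (List.in_map (fun c => c \o fst)).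
  right; apply: (List.in_map (fun j (wv : Om * 'rV[K]_n) => wv.2 0 j)).
  have : j \in enum 'I_n by rewrite mem_enum.
  elim: (enum 'I_n) => // i s IH; rewrite inE => /orP[/eqP->|/IH]; by [left|right].
(* The variables below [N] stand for [cs] and the next [n] for the coordinates of [v]; only the
   latter are quantified. *)
pose N := size cs; pose g := foldr GRing.Exists f (iota N n).
have rg : GRing.rformula g by rewrite /g; elim: (iota N n).
have /andP[qQ rQ] := GRing.quantifier_elim_wf (@ClosedFieldQE.wf_ex_elim K) rg.
apply: (@constr_ext _ _ _ (fun w => GRing.holds [seq c w | c <- cs] (QE g)));
  last exact: formula_constr.
move=> w; rewrite QE_holds //.
have env_fs v : [seq c (w, v) | c <- fs] =
    [seq c w | c <- cs] ++ [seq v 0 j | j <- enum 'I_n].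
  by rewrite /fs map_cat -!map_comp.
have sz (v : 'rV[K]_n) : size [seq v 0 j | j <- enum 'I_n] = n.
  by rewrite size_map -cardE card_ord.
rewrite /g; split=> [/GRing.foldExistsP[e' he' fe']|[v Pv]].
  pose v : 'rV[K]_n := \row_j nth 0 e' (N + j)%N.
  exists v; rewrite -hf env_fs; apply: GRing.eq_holds fe'.
  move=> i; rewrite nth_cat size_map -/N.
  have [lt_i|ge_i] := ltnP i N.
    by rewrite -he' // inE mem_iota; lia.
  have [lt_i|ge_i'] := ltnP (i - N) n.
    rewrite (nth_map (Ordinal lt_i)) ?size_enum_ord // mxE nth_enum_ord //.
    by rewrite subnKC.
  have <- : nth 0 [seq c w | c <- cs] i = nth 0 e' i.
    by apply: he'; rewrite inE mem_iota; lia.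
  by rewrite !nth_default ?sz ?size_map.
apply/GRing.foldExistsP; exists [seq c (w, v) | c <- fs]; last by rewrite hf.
move=> i; rewrite inE mem_iota env_fs nth_cat size_map -/N => hi.
case: ltnP => // ge_i; rewrite !nth_default ?sz ?size_map //; lia.
Qed.

End Projection.

(** * Dimension by growth of functions *)

Section Dimension.
Variables (K : fieldType) (Om : Type).
Implicit Types (Z W : set Om) (G : set (Om -> K)).

Definition spanned (I : finType) (g : I -> Om -> K) Z (f : Om -> K) : Prop :=
  exists a : I -> K, forall w, Z w -> f w = \sum_i a i * g i w.

Definition independent (I : finType) (g : I -> Om -> K) Z : Prop :=
  forall a : I -> K, (forall w, Z w -> \sum_i a i * g i w = 0) ->
    forall i, a i = 0.

(* The polynomials of degree at most d in G restricted to Z span a space of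
   dimension O(d ^ m): the image of Z under the functions G has dimension at
   most m. *)
Definition dim_le Z G m : Prop :=
  exists c, forall d, exists (I : finType) (g : I -> Om -> K),
    (#|I| <= c * d.+1 ^ m)%N /\ forall p, pol G d p -> spanned g Z p.

Lemma leq_expl m a b : (a <= b -> a ^ m <= b ^ m)%N.
Proof. by case: m => // m ab; rewrite leq_exp2r. Qed.

(** Rescaling the degree by a constant costs a constant factor and leaves the exponent [m]
    unchanged. *)
Lemma leq_growth m d e c : (c * (d * e).+1 ^ m <= c * e.+1 ^ m * d.+1 ^ m)%N.
Proof. by rewrite -mulnA -expnMn leq_mul2l leq_expl ?orbT //; nia. Qed.

Lemma spanned_add (I : finType) (g : I -> Om -> K) Z p q :
  spanned g Z p -> spanned g Z q -> spanned g Z (fun w => p w + q w).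
Proof.
move=> [a ha] [b hb]; exists (fun i => a i + b i) => w Zw.
by rewrite ha // hb // -big_split; apply: eq_bigr => i _; rewrite mulrDl.
Qed.

Lemma dim_le_pol Z G G' m e : (forall g, G' g -> pol G e g) ->
  dim_le Z G m -> dim_le Z G' m.
Proof.
move=> GG [c hc]; exists (c * e.+1 ^ m)%N => d.
have [I [g [cI hI]]] := hc (d * e)%N; exists I, g; split.
  exact: leq_trans cI (leq_growth _ _ _ _).
by move=> p /(pol_trans GG)/hI.
Qed.

Lemma dim_le_gen Z G G' m : G' `<=` G -> dim_le Z G m -> dim_le Z G' m.
Proof. by move=> GG; apply: (@dim_le_pol Z G G' m 1) => g /GG; apply: PolGen. Qed.

Lemma dim_le_sub Z Z' G m : Z' `<=` Z -> dim_le Z G m -> dim_le Z' G m.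
Proof.
move=> ZZ [c hc]; exists c => d; have [I [g [cI hI]]] := hc d.
by exists I, g; split=> // p /hI[a ha]; exists a => w /ZZ; apply: ha.
Qed.

Lemma dim_le_leq Z G m m' : (m <= m')%N -> dim_le Z G m -> dim_le Z G m'.
Proof.
move=> mm [c hc]; exists c => d; have [I [g [cI hI]]] := hc d.
exists I, g; split=> //; apply: leq_trans cI _.
by rewrite leq_mul2l leq_pexp2l ?orbT.
Qed.

(** The spanning functions in [dim_le] need not be polynomials, so those of the two sets can be
    extended by zero and put side by side. *)
Lemma dim_le_union Z Z' G m :
  dim_le Z G m -> dim_le Z' G m -> dim_le (Z `|` Z') G m.
Proof.
move=> [c hc] [c' hc']; exists (c + c')%N => d.
have [I [g [cI hI]]] := hc d; have [J [h [cJ hJ]]] := hc' d.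
exists (I + J)%type, (fun k w => match k with
  | inl i => if pselect (Z w) then g i w else 0
  | inr j => if pselect (Z w) then 0 else h j w end); split.
  by rewrite card_sum mulnDl leq_add.
move=> p pd; have [a ha] := hI _ pd; have [b hb] := hJ _ pd.
exists (fun k => match k with inl i => a i | inr j => b j end) => w ZZw.
rewrite big_sumType /=; case: pselect => [Zw|nZw].
  rewrite [X in _ + X]big1 ?addr0 ?ha // => j _; exact: mulr0.
rewrite [X in X + _]big1 ?add0r => [|j _]; last exact: mulr0.
by rewrite hb //; case: ZZw.
Qed.

Lemma dim_le0 G m : dim_le set0 G m.
Proof.
exists 0%N => d; exists 'I_0, (fun=> fun=> 0); rewrite card_ord; split=> // p _.
by exists (fun=> 0).
Qed.

Lemma dim_le_bigcup (I : finType) (Z : I -> set Om) G m :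
  (forall i, dim_le (Z i) G m) -> dim_le [set w | exists i, Z i w] G m.
Proof.
move=> hZ; suff h (s : seq I) : dim_le [set w | exists2 i, i \in s & Z i w] G m.
  apply: dim_le_sub (h (enum I)) => w [i Ziw]; exists i; by rewrite ?mem_enum.
elim: s => [|i s IH].
  by apply: dim_le_sub (dim_le0 G m) => w [].
apply: dim_le_sub (dim_le_union (hZ i) IH) => w [j].
by rewrite inE => /orP[/eqP->|js] Zjw; [left|right; exists j].
Qed.

Lemma dim_le_set0 Z : dim_le Z set0 0.
Proof.
exists 1%N => d; exists 'I_1, (fun=> fun=> 1); split; first by rewrite card_ord.
move=> p pd; have [c ->] : exists c, p = fun=> c.
  elim: {d} pd => //.
  - by move=> _ c; exists c.
  - by move=> _ _ _ _ [a ->] _ [b ->]; exists (a + b).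
  - by move=> _ _ _ _ _ [a ->] _ [b ->]; exists (a * b).
by exists (fun=> c) => w _; rewrite big_ord1 mulr1.
Qed.

(** Finite sums of products. Both factors keep the bound [d], which is wasteful but harmless, since
    only the exponent of growth matters. *)
Inductive tensor G G' d : (Om -> K) -> Prop :=
| TensorMul p q : pol G d p -> pol G' d q -> tensor G G' d (fun w => p w * q w)
| TensorAdd p q : tensor G G' d p -> tensor G G' d q ->
    tensor G G' d (fun w => p w + q w).

Lemma pol_tensor G G' d p : pol (G `|` G') d p -> tensor G G' d p.
Proof.
elim=> {d p}.
- move=> d c; rewrite (_ : (fun=> c) = fun w : Om => c * 1).
    by apply: TensorMul; apply: PolConst.
  by apply/funext => w; rewrite mulr1.
- move=> d g [Gg|G'g].
    rewrite (_ : g = fun w : Om => g w * 1).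
      by apply: TensorMul; [apply: PolGen|apply: PolConst].
    by apply/funext => w; rewrite mulr1.
  rewrite (_ : g = fun w : Om => 1 * g w).
    by apply: TensorMul; [apply: PolConst|apply: PolGen].
  by apply/funext => w; rewrite mul1r.
- by move=> d p q _ + _ +; apply: TensorAdd.
- move=> d e p q _ + _ tq; elim=> {p} [p p' dp dp'|p1 p2 _ IH1 _ IH2].
    elim: tq => {q} [q q' dq dq'|q1 q2 _ IH1 _ IH2].
      rewrite (_ : (fun w => _) = fun w => (p w * q w) * (p' w * q' w)).
        by apply: TensorMul; apply: PolMul.
      by apply/funext => w; rewrite mulrACA.
    rewrite (_ : (fun w => _) =
      fun w => p w * p' w * q1 w + p w * p' w * q2 w); first exact: TensorAdd.
    by apply/funext => w; rewrite mulrDr.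
  rewrite (_ : (fun w => _) = fun w => p1 w * q w + p2 w * q w).
    exact: TensorAdd.
  by apply/funext => w; rewrite mulrDl.
Qed.

Lemma dim_le_join Z G G' m m' :
  dim_le Z G m -> dim_le Z G' m' -> dim_le Z (G `|` G') (m + m').
Proof.
move=> [c hc] [c' hc']; exists (c * c')%N => d.
have [I [g [cI hI]]] := hc d; have [J [h [cJ hJ]]] := hc' d.
exists (I * J)%type, (fun k w => g k.1 w * h k.2 w); split.
  by rewrite card_prod expnD mulnACA leq_mul.
move=> p /pol_tensor; elim=> {p} [p q /hI[a ha] /hJ[b hb]|p q _ + _ +].
  exists (fun k => a k.1 * b k.2) => w Zw; rewrite ha // hb // big_distrlr /=.
  by rewrite pair_bigA; apply: eq_bigr => k _; rewrite mulrACA.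
exact: spanned_add.
Qed.

Inductive horner G (c : Om -> K) d : (Om -> K) -> Prop :=
| HornerMul i r : (i <= d)%N -> pol G d r -> horner G c d (fun w => r w * c w ^+ i)
| HornerAdd p q : horner G c d p -> horner G c d q ->
    horner G c d (fun w => p w + q w).

Lemma pol_horner G c d p : pol (G `|` [set c]) d p -> horner G c d p.
Proof.
elim=> {d p}.
- move=> d a; rewrite (_ : (fun=> a) = fun w : Om => a * c w ^+ 0).
    by apply: HornerMul => //; apply: PolConst.
  by apply/funext => w; rewrite expr0 mulr1.
- move=> d g [Gg| ->].
    rewrite (_ : g = fun w : Om => g w * c w ^+ 0).
      by apply: HornerMul => //; apply: PolGen.
    by apply/funext => w; rewrite expr0 mulr1.
  have : horner G c d.+1 (fun w => 1 * c w ^+ 1).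
    by apply: HornerMul => //; apply: PolConst.
  by congr horner; apply/funext => w; rewrite mul1r expr1.
- by move=> d p q _ + _ +; apply: HornerAdd.
- move=> d e p q _ + _ tq; elim=> {p} [i p di dp|p1 p2 _ IH1 _ IH2].
    elim: tq => {q} [j q dj dq|q1 q2 _ IH1 _ IH2].
      rewrite (_ : (fun w => _) = fun w => (p w * q w) * c w ^+ (i + j)).
        by apply: HornerMul; [apply: leq_add|apply: PolMul].
      by apply/funext => w; rewrite mulrACA -exprD.
    rewrite (_ : (fun w => _) =
      fun w => p w * c w ^+ i * q1 w + p w * c w ^+ i * q2 w).
      exact: HornerAdd.
    by apply/funext => w; rewrite mulrDr.
  rewrite (_ : (fun w => _) = fun w => p1 w * q w + p2 w * q w).
    exact: HornerAdd.
  by apply/funext => w; rewrite mulrDl.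
Qed.

Lemma dim_le_set1 Z c : dim_le Z [set c] 1.
Proof.
exists 1%N => d; exists 'I_d.+1, (fun (i : 'I_d.+1) w => c w ^+ i).
split; first by rewrite card_ord mul1n expn1.
move=> p pd; have {pd}: pol (set0 `|` [set c]) d p by rewrite set0U.
move=> /pol_horner; elim=> {p} [i r di dr|p q _ + _ +]; last exact: spanned_add.
have [a ->] : exists a, r = fun=> a.
  elim: {di} dr => //.
  - by move=> _ a; exists a.
  - by move=> _ _ _ _ [a ->] _ [b ->]; exists (a + b).
  - by move=> _ _ _ _ _ [a ->] _ [b ->]; exists (a * b).
exists (fun j : 'I_d.+1 => if j == i :> nat then a else 0) => w _.
rewrite (bigD1 (inord i)) //= inordK ?ltnS // eqxx big1 ?addr0 // => j.
by rewrite -val_eqE /= inordK ?ltnS // => /negbTE->; rewrite mul0r.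
Qed.

(* If the generators G determine c up to an equation of degree e.+1 whose
   leading coefficient b never vanishes on Z, then b ^ d clears the denominators
   of the reductions of the polynomials of degree at most d. *)
Lemma dim_le_integral Z G m c e (b : Om -> K) (a : 'I_e.+1 -> Om -> K) :
  alg G b -> (forall j, alg G (a j)) -> (forall w, Z w -> b w != 0) ->
  (forall w, Z w -> b w * c w ^+ e.+1 = \sum_j a j w * c w ^+ j) ->
  dim_le Z G m -> dim_le Z (G `|` [set c]) m.
Proof.
move=> [db algb] alga b0 bE [k hk].
have [D Db Da] : exists2 D, pol G D b & forall j, pol G D (a j).
  have [da Da] := choice alga; exists (maxn db (\max_j da j)).
    by apply: pol_leq algb; apply: leq_maxl.
  by move=> j; apply: pol_leq (Da j); rewrite leq_max leq_bigmax orbT.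
(* After multiplication by [b c], the only power of [c] that is too high is [c ^ e.+1], and [bE]
   replaces it. *)
have reduce i : exists2 q : 'I_e.+1 -> Om -> K, forall j, pol G (D * i) (q j) &
    forall w, Z w -> b w ^+ i * c w ^+ i = \sum_j q j w * c w ^+ j.
  elim: i => [|i [q dq qE]].
    exists (fun j w => if j == 0 :> nat then 1 else 0).
      by move=> j; case: eqP => _; apply: PolConst.
    move=> w _; rewrite big_ord_recl big1 => [|j _]; last by rewrite mul0r.
    by rewrite /= !expr0 !mulr1 addr0.
  exists (fun j w => q ord_max w * a j w +
      (if (j : nat) is j'.+1 then b w * q (inord j') w else 0)).
    move=> j; apply: PolAdd; first by rewrite mulnS addnC; apply: PolMul.
    by case: (nat_of_ord j) => [|j']; [apply: PolConst|rewrite mulnS; apply: PolMul].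
  move=> w Zw; rewrite !exprS mulrACA qE //.
  have -> : \sum_j (q ord_max w * a j w + (if nat_of_ord j is j'.+1
      then b w * q (inord j') w else 0)) * c w ^+ j =
    q ord_max w * (b w * c w ^+ e.+1) + \sum_(j < e.+1) (if nat_of_ord j is j'.+1
      then b w * q (inord j') w else 0) * c w ^+ j.
    rewrite bE // mulr_sumr -big_split; apply: eq_bigr => j _ /=.
    by rewrite mulrDl mulrA.
  rewrite big_ord_recr big_ord_recl /= mul0r add0r mulrDr addrC mulr_sumr.
  congr (_ + _); first by rewrite exprS; ring.
  apply: eq_bigr => j _; rewrite exprS.
  have -> : inord j = widen_ord (leqnSn e) j :> 'I_e.+1.
    by apply/val_inj; rewrite /= inordK // ltnS ltnW.
  by ring.
(* Times [b ^ d], a term [r c ^ i] reduces to coefficients [r b ^ (d - i) q_j], of degree at most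
   [d + D (d - i) + D i = d F]. *)
pose F := D.+1.
exists (k * F.+1 ^ m * e.+1)%N => d.
have [I [g [cI hI]]] := hk (d * F)%N.
exists (I * 'I_e.+1)%type, (fun (u : I * 'I_e.+1) w => g u.1 w * c w ^+ u.2 / b w ^+ d); split.
  rewrite card_prod card_ord mulnAC leq_mul2r /=.
  exact: leq_trans cI (leq_growth _ _ _ _).
move=> p /pol_horner; elim=> {p} [i r di dr|p q _ + _ +]; last exact: spanned_add.
have [q dq qE] := reduce i.
have /choice[A hA] j : spanned g Z (fun w => r w * b w ^+ (d - i) * q j w).
  apply: hI; apply: (@pol_leq _ _ _ (d + D * (d - i) + D * i)); first by rewrite /F; nia.
  apply: PolMul => //; apply: PolMul => //.
  elim: (d - i)%N => [|l IH]; first exact: PolConst.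
  rewrite (_ : (fun w => _) = fun w => b w * b w ^+ l); last first.
    by apply/funext => w; rewrite exprS.
  by rewrite mulnS; apply: PolMul.
exists (fun u => A u.2 u.1) => w Zw.
rewrite -(pair_bigA _ (fun i' (j : 'I_e.+1) => A j i' * (g i' w * c w ^+ j / b w ^+ d))) /=.
rewrite exchange_big /=.
have bd : b w ^+ d != 0 by rewrite expf_neq0 // b0.
apply: (mulfI bd); rewrite mulr_sumr.
under eq_bigr => j _.
  under eq_bigr do rewrite mulrA mulrA.
  rewrite -mulr_suml -mulr_suml -hA // mulrC divfK //.
  over.
rewrite -{1}(subnK di) exprD.
transitivity (r w * b w ^+ (d - i) * (b w ^+ i * c w ^+ i)); first by ring.
by rewrite qE // mulr_sumr; apply: eq_bigr => j _; rewrite mulrA.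
Qed.

End Dimension.

(** A choice of preimages carries the spanning functions from [Z] to its image. *)
Lemma dim_le_image (K : fieldType) (Om Om' : Type) (f : Om -> Om') Z
    (G : set (Om' -> K)) m :
  dim_le Z (pull f G) m -> dim_le [set w' | exists2 w, Z w & f w = w'] G m.
Proof.
move=> [c hc]; exists c => d; have [I [g [cI hI]]] := hc d.
pose s w' : option Om := if pselect (exists2 w, Z w & f w = w') is left h
  then Some (projT1 (cid2 h)) else None.
exists I, (fun i w' => oapp (g i) 0 (s w')); split=> // p /(pol_pull f)/hI[a ha].
exists a => w' h'; rewrite /s; case: pselect => // h /=.
by case: (cid2 h) => w /= Zw <-; apply: ha.
Qed.

(** * Dimension drops under strict inclusion in an irreducible closure *)

Section Specialization.
Variables (K : fieldType) (Om : Type).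
Implicit Types (Z W : set Om) (G : set (Om -> K)).

Lemma independent_card (I J : finType) (g : I -> Om -> K) (h : J -> Om -> K) Z :
  independent h Z -> (forall j, spanned g Z (h j)) -> (#|J| <= #|I|)%N.
Proof.
move=> ind /choice[A hA]; rewrite leqNgt; apply/negP => lt.
pose M := \matrix_(j < #|J|, i < #|I|) A (enum_val j) (enum_val i).
have /rowV0Pn[v /sub_kermxP vM v0] : kermx M != 0.
  rewrite -mxrank_eq0 mxrank_ker subn_eq0 -ltnNge.
  exact: leq_ltn_trans (rank_leq_col M) lt.
case/negP: v0; apply/eqP/rowP => j; rewrite mxE.
have <- := ind (fun j => v 0 (enum_rank j)) _ (enum_val j).
  by rewrite enum_valK.
move=> w Zw; under eq_bigr => j' _ do rewrite hA // mulr_sumr.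
rewrite exchange_big big1 //= => i _.
have := congr1 (fun N : 'rV__ => N 0 (enum_rank i)) vM; rewrite !mxE => vM0.
under eq_bigr => j' _ do rewrite mulrA.
rewrite -mulr_suml (_ : \sum_j' _ = 0) ?mul0r // -[RHS]vM0.
rewrite (reindex (@enum_val J predT)) /=; last exact/onW_bij/enum_val_bij.
by apply: eq_bigr => j' _; rewrite enum_valK !mxE enum_rankK.
Qed.

(** A maximal independent family among the functions of degree at most [d]. It consists of
    polynomials, unlike [g], so linear relations found on a set extend to its closure. *)
Lemma exists_basis (I : finType) (g : I -> Om -> K) Z G d :
  (forall p, pol G d p -> spanned g Z p) ->
  exists N (h : 'I_N -> Om -> K), [/\ forall i, pol G d (h i), independent h Z &
    forall p, pol G d p -> spanned h Z p].
Proof.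
move=> gG; pose ok N := exists h : 'I_N -> Om -> K,
  (forall i, pol G d (h i)) /\ independent h Z.
have ok0 : exists N, `[< ok N >].
  by exists 0%N; apply/asboolP; exists (fun=> fun=> 0); split=> [[]|a _ []].
have okI N : `[< ok N >] -> (N <= #|I|)%N.
  move=> /asboolP[h [hG ind]]; rewrite -[N]card_ord.
  by apply: independent_card ind _ => j; apply: gG.
case: (ex_maxnP ok0 okI) => N /asboolP[h [hG ind]] maxN.
exists N, h; split=> // p pG; apply: contrapT => nsp.
suff /asboolP/maxN : ok N.+1 by rewrite ltnn.
exists (fun i => oapp h p (unlift ord_max i)); split.
  by move=> i; case: unliftP => [j|] _ //=; apply: hG.
move=> a ha.
have sumE w : Z w -> \sum_i a (lift ord_max i) * h i w + a ord_max * p w = 0.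
  move=> /ha; rewrite (bigD1_ord ord_max) //= unlift_none /= addrC => E.
  by rewrite -[RHS]E; congr (_ + _); apply: eq_bigr => i _; rewrite liftK.
have a0 : a ord_max = 0.
  apply/eqP/negPn/negP => a0; apply: nsp.
  exists (fun i => - (a ord_max)^-1 * a (lift ord_max i)) => w /sumE /eqP.
  rewrite addr_eq0 => /eqP E; apply: (mulfI a0); rewrite mulr_sumr -[LHS]opprK -E.
  rewrite -sumrN; apply: eq_bigr => i _.
  by rewrite mulNr mulNr mulrN -mulrA mulVKf.
move=> i; case: (unliftP ord_max i) => [j ->|-> //].
apply: (ind (fun j => a (lift ord_max j))) => w /sumE.
by rewrite a0 mul0r addr0.
Qed.

(** Irreducibility of the closure of [W], as primality of its ideal. The set itself need not be
    closed, so that sums and lines can be used as they are. *)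
Definition prime_set W G : Prop := W !=set0 /\
  forall p q, alg G p -> alg G q -> (forall w, W w -> p w * q w = 0) ->
    (forall w, W w -> p w = 0) \/ (forall w, W w -> q w = 0).

Definition closure_sub Z W G : Prop :=
  forall p, alg G p -> (forall w, W w -> p w = 0) -> forall w, Z w -> p w = 0.

Definition proper_in Z W G : Prop := closure_sub Z W G /\ ~ closure_sub W Z G.

(* If f vanishes on Z but not on W, then the f ^ i h_j are linearly independent
   on W as soon as the h_j are so on Z. *)
Lemma dim_le_proper_basis Z W G m : prime_set W G -> proper_in Z W G ->
  dim_le W G m -> exists c, forall d, exists N (h : 'I_N -> Om -> K),
    [/\ (d.+1 * N <= c * d.+1 ^ m)%N, independent h Z &
      forall p, pol G d p -> spanned h Z p].
Proof.
move=> [_ primeW] [ZW nWZ] [c hc].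
have [f [[e fe] fZ [w0 Ww0 fw0]]] : exists f, [/\ alg G f,
    (forall w, Z w -> f w = 0) & exists2 w, W w & f w <> 0].
  apply: contrapT => h; apply: nWZ => p ap pZ w Ww; apply: contrapT => pw.
  by apply: h; exists p; split=> //; exists w.
exists (c * e.+2 ^ m)%N => d.
have [I [g [cI hI]]] := hc (d * e.+1)%N.
have polW p : pol G d p -> spanned g W p by move=> pd; apply/hI/pol_leq/pd; nia.
(* A polynomial basis on [W] comes first: the relations it gives are polynomial identities on [W],
   hence hold on [Z]. So it spans on [Z] too, and yields a family independent there. *)
have [N [h [hG ind hsp]]] : exists N (h : 'I_N -> Om -> K),
    [/\ forall i, pol G d (h i), independent h Z &
    forall p, pol G d p -> spanned h Z p].
  have [N' [h' [hG' _ hsp']]] := exists_basis polW.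
  apply: (@exists_basis _ h') => p pd; have [a ha] := hsp' p pd.
  exists a => w Zw; apply/eqP; rewrite -subr_eq0; apply/eqP.
  apply: (ZW (fun w => p w - \sum_i a i * h' i w)) => // [|w' Ww'].
    apply: alg_sub; first by exists d.
    by apply: alg_sum => i; apply: alg_mul; [apply: alg_const|exists d].
  by rewrite ha // subrr.
exists N, h; split=> //.
apply: leq_trans (leq_trans cI (leq_growth _ _ _ _)).
rewrite -[d.+1]card_ord -[N in leqLHS]card_ord -card_prod.
apply: (@independent_card _ _ _
  (fun u : 'I_d.+1 * 'I_N => fun w => f w ^+ u.1 * h u.2 w) W); last first.
  move=> [i j] /=; apply: hI; apply: (@pol_leq _ _ _ (i * e + d)).
    by have := ltn_ord i; nia.
  apply: PolMul => //; elim: (nat_of_ord i) => [|k IH]; first exact: PolConst.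
  rewrite (_ : (fun w => _) = fun w => f w * f w ^+ k); last first.
    by apply/funext => w; rewrite exprS.
  by rewrite mulSn; apply: PolMul.
(* Induction on the number of powers of [f]: on [Z] only the term of [f ^ 0] survives, and its
   coefficients vanish by independence there; primality of [W] then cancels a factor [f]. *)
suff key k : forall b : nat -> 'I_N -> K,
    (forall w, W w -> \sum_(i < k) f w ^+ i * \sum_j b i j * h j w = 0) ->
    forall i j, (i < k)%N -> b i j = 0.
  move=> a ha [i j].
  have := key d.+1 (fun i j => a (inord i, j)) _ i j (ltn_ord i).
  rewrite inord_val; apply=> w /ha E; rewrite -[RHS]E.
  under eq_bigr do rewrite mulr_sumr.
  rewrite pair_bigA; apply: eq_bigr => -[i' j'] _ /=.
  by rewrite inord_val; ring.
elim: k => // k IH b hb.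
have algs i0 : alg G (fun w => \sum_(i < k) f w ^+ i *
    \sum_j b (i0 + i)%N j * h j w).
  apply: alg_sum => i; apply: alg_mul; first by apply: alg_exp; exists e.
  by apply: alg_sum => j; apply: alg_mul; [apply: alg_const|exists d].
have algb0 : alg G (fun w => \sum_j b 0%N j * h j w).
  by apply: alg_sum => j; apply: alg_mul; [apply: alg_const|exists d].
have splitE w : \sum_(i < k.+1) f w ^+ i * \sum_j b i j * h j w =
    \sum_j b 0%N j * h j w +
      f w * \sum_(i < k) f w ^+ i * \sum_j b (1 + i)%N j * h j w.
  rewrite big_ord_recl /= mul1r mulr_sumr; congr (_ + _); apply: eq_bigr => i _.
  by rewrite /bump /= exprS mulrA.
have b0 j : b 0%N j = 0.
  apply: (ind (b 0%N)) => w Zw.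
  have : \sum_j b 0%N j * h j w +
      f w * \sum_(i < k) f w ^+ i * \sum_j b (1 + i)%N j * h j w = 0.
    apply: (ZW (fun w => \sum_j b 0%N j * h j w +
      f w * \sum_(i < k) f w ^+ i * \sum_j b (1 + i)%N j * h j w)) => // [|w' Ww'].
      by apply: alg_add => //; apply: alg_mul => //; exists e.
    by rewrite -splitE hb.
  by rewrite fZ // mul0r addr0.
have tail w : W w -> \sum_(i < k) f w ^+ i * \sum_j b (1 + i)%N j * h j w = 0.
  have := primeW f _ _ (algs 1%N); case=> //; first by exists e.
    move=> w' Ww'; rewrite -[RHS](hb w') // splitE [X in X + _]big1 ?add0r //.
    by move=> j _; rewrite b0 mul0r.
    by move/(_ w0 Ww0)/fw0.
  by apply.
case=> [|i] j ik; first exact: b0.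
by apply: (IH (fun i => b i.+1)).
Qed.

(** The factor [d.+1] gained from the powers of [f] cancels one factor of the growth bound. *)
Lemma dim_le_proper Z W G m : prime_set W G -> proper_in Z W G ->
  dim_le W G m.+1 -> dim_le Z G m.
Proof.
move=> pW ZW /(dim_le_proper_basis pW ZW)[c hc]; exists c => d.
have [N [h [hN _ hsp]]] := hc d; exists 'I_N, h; split=> //.
by move: hN; rewrite card_ord expnS mulnCA leq_mul2l.
Qed.

Lemma dim_le0_proper Z W G : prime_set W G -> proper_in Z W G -> Z !=set0 ->
  ~ dim_le W G 0.
Proof.
move=> pW ZW [w0 Zw0] /(dim_le_proper_basis pW ZW)[c hc].
(* In degree [c] the bound reads [c.+1 * N <= c], so [N = 0]; but the constant 1 is nonzero on
   [Z]. *)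
have [N [h [hN _ hsp]]] := hc c; case: N h hN hsp => [|N] h hN hsp.
  have [a ha] := hsp (fun=> 1) (PolConst _ _ _); have := ha _ Zw0.
  by rewrite big_ord0 => /eqP; rewrite oner_eq0.
by move: hN; rewrite expn0 muln1; nia.
Qed.

End Specialization.

(** * Finite fibres *)

Section FiniteFibers.
Variables (K : closedFieldType) (Om : Type).
Implicit Types (Z : set Om) (G : set (Om -> K)).

Definition finite_pred (T : eqType) (P : T -> Prop) : Prop :=
  exists s : seq T, forall x, P x -> x \in s.

Lemma poly_nonroot (p : {poly K}) : p != 0 -> exists t, p.[t] != 0.
Proof. by move=> p0; apply/closed_nonrootP. Qed.

Lemma ext1_coefs G p : alg (pull fst G `|` [set snd]) p ->
  exists e (a : nat -> Om -> K), (forall i, alg G (a i)) /\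
    forall w t, p (w, t) = (\poly_(i < e) a i w).[t].
Proof.
move=> [d /pol_horner]; elim=> {p} [i r di dr|p q _ [e [a [aG aE]]] _ [e' [b [bG bE]]]].
  have {dr}[s sG sE] : exists2 s, alg G s & forall w t, r (w, t) = s w.
    elim: {d di} dr => {r}.
    - by move=> d c; exists (fun=> c) => //; apply: alg_const.
    - by move=> d _ [g Gg ->]; exists g => //; apply: alg_gen.
    - move=> d p q _ [s sG sE] _ [s' sG' sE']; exists (fun w => s w + s' w).
        exact: alg_add.
      by move=> w t; rewrite sE sE'.
    - move=> d d' p q _ [s sG sE] _ [s' sG' sE']; exists (fun w => s w * s' w).
        exact: alg_mul.
      by move=> w t; rewrite sE sE'.
  exists i.+1, (fun j w => if j == i then s w else 0); split.
    by move=> j; case: eqP => _ //; apply: alg_const.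
  move=> w t; rewrite horner_poly big_ord_recr /= eqxx sE big1 ?add0r // => j _.
  by rewrite ltn_eqF ?mul0r.
exists (maxn e e'), (fun i w => (if (i < e)%N then a i w else 0) +
  (if (i < e')%N then b i w else 0)); split.
  move=> i; apply: alg_add; first by case: (i < e)%N => //; apply: alg_const.
  by case: (i < e')%N => //; apply: alg_const.
move=> w t; rewrite aE bE -hornerD; congr (_.[_]); apply/polyP => i.
rewrite coefD !coef_poly leq_max.
by case: (i < e)%N; case: (i < e')%N; rewrite ?addr0 ?add0r.
Qed.

(** The degree of the equation varies with [w]. For each of its finitely many values [k], the
    coefficient [a k] has no zero on the corresponding piece and [dim_le_integral] applies. Degree 0
    cannot occur, as a nonzero constant has no root. *)
Lemma dim_le_root Z G m c e (a : nat -> Om -> K) :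
  (forall i, alg G (a i)) ->
  (forall w, Z w -> \poly_(i < e) a i w != 0) ->
  (forall w, Z w -> (\poly_(i < e) a i w).[c w] = 0) ->
  dim_le Z G m -> dim_le Z (G `|` [set c]) m.
Proof.
move=> aG a0 ac dZ.
pose Zk (k : 'I_e) w := [/\ Z w, a k w != 0 &
  (\sum_(i < k.+1) a i w * c w ^+ i = 0)].
have : dim_le [set w | exists k, Zk k w] (G `|` [set c]) m.
  apply: dim_le_bigcup => -[[|k] ltk].
    apply: dim_le_sub (@dim_le0 _ _ (G `|` [set c]) m) => w [Zw /= ak]; rewrite big_ord1 expr0 mulr1.
    by move/eqP; rewrite (negPf ak).
  apply: (@dim_le_integral _ _ _ _ _ _ k (a k.+1)
    (fun (j : 'I_k.+1) w => - a j w)) => //.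
  - by move=> j; apply: alg_opp.
  - by move=> w [].
  - move=> w [_ _ /=]; rewrite big_ord_recr /= addrC => /eqP.
    by rewrite addr_eq0 => /eqP ->; rewrite -sumrN; apply: eq_bigr => j _; rewrite mulNr.
  by apply: dim_le_sub dZ => w [].
apply: dim_le_sub => w Zw.
set p := \poly_(i < e) a i w; have p0 : p != 0 := a0 w Zw.
have sp : (0 < size p)%N by rewrite size_poly_gt0.
have lte : ((size p).-1 < e)%N by have := size_poly e (a^~ w); rewrite -/p; lia.
exists (Ordinal lte); split=> //=.
  have : lead_coef p != 0 by rewrite lead_coef_eq0.
  by rewrite lead_coefE coef_poly lte.
rewrite prednK // -[RHS](ac w Zw) -/p horner_coef; apply: eq_bigr => i _.
by rewrite coef_poly (leq_trans (ltn_ord i)) // size_poly.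
Qed.

(** Some polynomial of the pattern vanishes at [c w] without vanishing identically over [w].
    Otherwise all but finitely many [t] would have the pattern of [c w] and the fibre would be
    infinite. Each such polynomial makes [c] algebraic over [G] on a piece of [Z]. *)
Lemma dim_le_fiber1 Z G m c (P : Om * K -> Prop) :
  constr (pull fst G `|` [set snd]) P -> (forall w, Z w -> P (w, c w)) ->
  (forall w, Z w -> finite_pred (fun t => P (w, t))) ->
  dim_le Z G m -> dim_le Z (G `|` [set c]) m.
Proof.
move=> /constr_pattern[ps [algps hps]] Pc Pfin dZ.
pose root_of p w := exists e (a : nat -> Om -> K), [/\ forall i, alg G (a i),
  forall w t, p (w, t) = (\poly_(i < e) a i w).[t],
  \poly_(i < e) a i w != 0 & p (w, c w) = 0].
have cover w : Z w -> exists2 p, List.In p ps & root_of p w.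
  move=> Zw; apply: contrapT => nroot.
  have [q q0 hq] : exists2 q : {poly K}, q != 0 & forall t, q.[t] != 0 ->
      forall p, List.In p ps -> p (w, c w) = 0 <-> p (w, t) = 0.
    have {nroot} : forall p, List.In p ps -> ~ root_of p w.
      by move=> p psp h; apply: nroot; exists p.
    elim: (ps) algps => [|p s IH] algs nroot.
      by exists 1 => //; rewrite oner_neq0.
    have [q q0 hq] := IH (fun p h => algs p (or_intror h)) (fun p h => nroot p (or_intror h)).
    have [e [a [aG aE]]] := ext1_coefs (algs p (or_introl erefl)).
    have [pw0|pw0] := eqVneq (\poly_(i < e) a i w) 0.
      exists q => // t /hq{}hq p' [<-|/hq//].
      by rewrite !aE pw0 !horner0.
    exists (q * \poly_(i < e) a i w); first by rewrite mulf_neq0.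
    move=> t; rewrite hornerM mulf_eq0 negb_or => /andP[/hq{}hq /eqP pt].
    move=> p' [<-|/hq//]; split=> [pc|]; last by rewrite aE => /pt.
    by exfalso; apply: (nroot p (or_introl erefl)); exists e, a.
  have [s hs] := Pfin w Zw.
  have [t] : exists t, (q * \prod_(x <- s) ('X - x%:P)).[t] != 0.
    apply: poly_nonroot; rewrite mulf_neq0 //.
    by apply/monic_neq0/monic_prod => i _; apply: monicXsubC.
  rewrite hornerM mulf_eq0 negb_or => /andP[/hq qt].
  suff /hs ts : P (w, t) by rewrite -[_ == 0]/(root _ t) root_prod_XsubC ts.
  exact: (hps (w, c w) (w, t)) qt (Pc w Zw).
have : forall s, (forall p, List.In p s -> alg (pull fst G `|` [set snd]) p) ->
    dim_le [set w | Z w /\ exists2 p, List.In p s & root_of p w] (G `|` [set c]) m.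
  elim=> [_|p s IH algs]; first by apply: dim_le_sub (@dim_le0 _ _ (G `|` [set c]) m) => w [_ []].
  have [e [a [aG aE]]] := ext1_coefs (algs p (or_introl erefl)).
  have d1 : dim_le [set w | [/\ Z w, \poly_(i < e) a i w != 0 & p (w, c w) = 0]]
      (G `|` [set c]) m.
    apply: (@dim_le_root _ _ _ _ e a) => //.
    - by move=> w [].
    - by move=> w [_ _]; rewrite aE.
    - by apply: dim_le_sub dZ => w [].
  have d2 := IH (fun p h => algs p (or_intror h)).
  apply: dim_le_sub (dim_le_union d1 d2) => w [Zw [p' [<-|sp'] hp']]; last first.
    by right; split=> //; exists p'.
  left; case: hp' => e' [a' [_ aE' pw0 pc]]; split=> //.
  have [t] := poly_nonroot pw0; rewrite -aE' aE => pt.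
  by apply/eqP => h; move: pt; rewrite h horner0 eqxx.
move=> /(_ ps algps); apply: dim_le_sub => w Zw; split=> //; exact: cover.
Qed.

End FiniteFibers.

Lemma coords_ext (K : fieldType) (Om : Type) n (t : Om -> 'rV[K]_n) G j :
  alg (G `|` coords t) (fun w => t w 0 j).
Proof. by apply: alg_coord => g; right. Qed.

(** The coordinates of [t] are adjoined one at a time. The values allowed for one of them form a
    projection of the fibre, constructible by [constr_proj] and still finite. *)
Lemma dim_le_fiber (K : closedFieldType) (Om : Type) (Z : set Om) G m n
    (t : Om -> 'rV[K]_n) (P : Om * 'rV[K]_n -> Prop) :
  constr (ext G) P -> (forall w, Z w -> P (w, t w)) ->
  (forall w, Z w -> finite_pred (fun v => P (w, v))) ->
  dim_le Z G m -> dim_le Z (G `|` coords t) m.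
Proof.
move=> cP Pt Pfin dZ.
suff key (s : seq 'I_n) :
    dim_le Z (G `|` [set c | exists2 j, j \in s & c = fun w => t w 0 j]) m.
  apply: dim_le_gen (key (enum 'I_n)) => c [Gc|[j ->]]; first by left.
  by right; exists j => //; rewrite mem_enum.
elim: s => [|j s IH]; first by apply: dim_le_gen dZ => c [//|[]].
pose Q (x : (Om * K) * 'rV[K]_n) := P (x.1.1, x.2) /\ x.2 0 j = x.1.2.
have cQ : constr (ext (pull fst G `|` [set snd])) Q.
  apply: ConstrAnd.
    apply: (@constr_comp _ _ _
      (fun x : (Om * K) * 'rV[K]_n => (x.1.1, x.2))) cP => _ [[g Gg ->]|[i ->]].
      by apply: alg_gen; left; exists (g \o fst) => //; left; exists g.
    by apply: alg_gen; right; exists i.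
  apply: constr_eq; first exact: coords_ext.
  by apply: alg_gen; left; exists snd => //; right.
apply: (@dim_le_gen _ _ _ (G `|` [set c | exists2 j, j \in s & c = fun w => t w 0 j]
   `|` [set fun w => t w 0 j])).
  move=> c [Gc|[i]]; first by left; left.
  by rewrite inE => /orP[/eqP->|si] ->; [right|left; right; exists i].
apply: (@dim_le_fiber1 _ _ _ _ _ _ (fun x => exists v, Q (x, v))) => //.
- apply: constr_subset (constr_proj cQ) => _ [[g Gg ->]| ->]; last by right.
  by left; exists g => //; left.
- by move=> w Zw; exists (t w); split=> //; apply: Pt.
- move=> w /Pfin[vs hvs]; exists [seq (v : 'rV[K]_n) 0 j | v <- vs] => x [v [/hvs vvs /= <-]].
  by apply/mapP; exists v.
Qed.

(** * Hilbert's basis theorem *)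

Section Noetherian.
Variables (K : fieldType) (n : nat).

Lemma nondecreasing_subseq (s : nat -> nat) : exists phi : nat -> nat,
  (forall i, phi i < phi i.+1)%N /\ (forall i, s (phi i) <= s (phi i.+1))%N.
Proof.
have /choice[mu hmu] k : exists i, (k <= i)%N /\ forall j, (k <= j)%N -> (s i <= s j)%N.
  have ex : exists x, `[< exists2 i, (k <= i)%N & s i = x >].
    by exists (s k); apply/asboolP; exists k.
  case: (ex_minnP ex) => x /asboolP[i ki <-] xmin.
  by exists i; split=> // j kj; apply: xmin; apply/asboolP; exists j.
exists (fun i => iter i (fun x => mu x.+1) (mu 0%N)); split=> i /=.
  by have [] := hmu (iter i (fun x => mu x.+1) (mu 0%N)).+1.
case: i => [|i] /=; have [h1 h2] := hmu 0%N.
  by apply: h2.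
set x := iter i _ _; have [h3 h4] := hmu x.+1; apply: h4.
by have [] := hmu (mu x.+1).+1; lia.
Qed.

Lemma increasing_lt (phi : nat -> nat) :
  (forall i, phi i < phi i.+1)%N -> forall i j, (i < j)%N -> (phi i < phi j)%N.
Proof.
move=> h i; elim=> // j IH; rewrite ltnS leq_eqVlt => /orP[/eqP->//|/IH/ltn_trans].
exact.
Qed.

(** Passing to subsequences, one coordinate after the other, leaves a sequence that is nondecreasing
    in all of them. *)
Lemma dickson (s : nat -> 'X_{1..n}) :
  exists i j, (i < j)%N /\ (s i <= s j)%MM.
Proof.
have [phi phi_lt phi_le] : exists2 phi : nat -> nat,
    (forall i, phi i < phi i.+1)%N &
    forall l i, l \in enum 'I_n -> (s (phi i) l <= s (phi i.+1) l)%N.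
  elim: (enum 'I_n) => [|l ls [phi lt le]]; first by exists id.
  have [psi [lt' le']] := nondecreasing_subseq (fun i => s (phi i) l).
  exists (phi \o psi) => [i|l' i] /=; first exact: increasing_lt.
  rewrite inE => /orP[/eqP->//|lls].
  have {lt'} : (psi i <= psi i.+1)%N by rewrite ltnW.
  elim: (psi i.+1) => [|k IH]; first by rewrite leqn0 => /eqP->.
  rewrite leq_eqVlt => /orP[/eqP->//|]; rewrite ltnS => /IH/leq_trans; apply.
  exact: le.
exists (phi 0%N), (phi 1%N); split=> //; apply/mnm_lepP => l.
by apply: phi_le; rewrite mem_enum.
Qed.

(* Otherwise Dickson's lemma, applied to the leading monomials of minimal
   elements of the union of the ideals I N outside I N, contradicts minimality. *)
Lemma hilbert_basis (f : nat -> {mpoly K[n]}) :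
  exists N (a : nat -> {mpoly K[n]}), f N = \sum_(i < N) a i * f i.
Proof.
apply: contrapT => nosol.
pose I N p := exists a : nat -> {mpoly K[n]}, p = \sum_(i < N) a i * f i.
have leI N M p : (N <= M)%N -> I N p -> I M p.
  move=> NM [a ->]; exists (fun i => if (i < N)%N then a i else 0).
  rewrite (big_ord_widen_cond _ xpredT (fun i => a i * f i) NM) big_mkcond.
  by apply: eq_bigr => i _ /=; case: ifP; rewrite ?mul0r.
have IM N p q : I N p -> I N (q * p).
  move=> [a ->]; exists (fun i => q * a i); rewrite mulr_sumr.
  by apply: eq_bigr => i _; rewrite mulrA.
have ID N p q : I N p -> I N q -> I N (p + q).
  move=> [a ->] [b ->]; exists (fun i => a i + b i); rewrite -big_split.
  by apply: eq_bigr => i _; rewrite mulrDl.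
have If N : I N.+1 (f N).
  exists (fun i => if i == N then 1 else 0); rewrite big_ord_recr /= eqxx mul1r.
  by rewrite big1 ?add0r // => i _; rewrite ltn_eqF ?mul0r.
pose S N p := (exists M, I M p) /\ ~ I N p.
have /choice[g hg] N : exists p, S N p /\
    forall q, S N q -> (mlead p <= mlead q)%O.
  have : S N (f N) by split; [exists N.+1|move=> [a h]; apply: nosol; exists N, a].
  move: (f N) => q Sq; apply: contrapT => nmin.
  move: {2}(mlead q) (erefl (mlead q)) => m Em; move: m q Em Sq.
  apply: (well_founded_ind (@ltom_wf n)) => m IH q Em Sq; apply: nmin.
  exists q; split=> // q' Sq'; rewrite leNgt; apply/negP => lt.
  by apply: (IH (mlead q') _ q' erefl Sq'); rewrite -Em.
have /choice[phi hphi] N : exists M, (N < M)%N /\ I M (g N).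
  have [[[M IM'] _] _] := hg N; exists (maxn M N.+1); split; first by lia.
  by apply: leI IM'; lia.
(* Along [u], each [g (u i)] lies in [I (u i.+1)], hence in [I (u j)] for every [j > i]. *)
pose u i := iter i phi 0%N.
have [i [j [ij le]]] := dickson (fun i => mlead (g (u i))).
have uij : (u i.+1 <= u j)%N.
  by apply: (homo_leq (@leqnn) (@leq_trans)) ij => k; have [/ltnW] := hphi (u k).
have [[[M IMj] nIj] minj] := hg (u j).
have Ii : I (u j) (g (u i)) by apply: leI uij _; have [] := hphi (u i).
have gi0 : g (u i) != 0.
  by apply/eqP => E; have [[_ []]] := hg (u i); rewrite E; exists (fun=> 0);
    rewrite big1 // => k _; rewrite mul0r.
set gi := g (u i) in le Ii gi0; set gj := g (u j) in IMj nIj minj le.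
set m := (mlead gj - mlead gi)%MM.
(* [h] lies in [I (u j)] and has the leading term of [gj], so [gj - h] stays outside [I (u j)] but
   has a smaller leading monomial. *)
pose h := (mleadc gj / mleadc gi) *: ('X_[m] * gi).
have Ih : I (u j) h.
  rewrite /h -[_ *: _]mul1r -scalerAr scalerAl; exact/IM/IM.
have hlead : (mlead h <= mlead gj)%O.
  apply: le_trans (mleadZ_le _ _) _; rewrite mleadM //; last by rewrite -msupp_eq0 msuppX.
  by rewrite mleadXm /m submK.
have hc : h@_(mlead gj) = mleadc gj.
  have E : mlead gj = (mlead ('X_[m] : {mpoly K[n]}) + mlead gi)%MM.
    by rewrite mleadXm /m submK.
  rewrite mcoeffZ {2}E mleadcM.
  by rewrite mleadXm mcoeffX eqxx mul1r divfK // mleadc_eq0.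
have Sh : S (u j) (gj - h).
  split; first exists (maxn M (u j)).
    apply: ID; first by apply: leI IMj; lia.
    by rewrite -mulN1r; apply: IM; apply: leI Ih; lia.
  by move=> Id; apply: nIj; rewrite -[gj](subrK h); apply: ID.
have d0 : gj - h != 0.
  apply/eqP => E; case: Sh => _; rewrite E; apply; exists (fun=> 0).
  by rewrite big1 // => k _; rewrite mul0r.
suff lt : (mlead (gj - h) < mlead gj)%O by have := minj _ Sh; rewrite leNgt lt.
rewrite lt_neqAle; apply/andP; split; last first.
  by apply: le_trans (mleadB_le _ _) _; rewrite leUx lexx hlead.
apply/eqP => E; move: d0; rewrite -mleadc_eq0 E mcoeffB hc subrr eqxx.
by [].
Qed.

(** The ascending chain condition in terms of values: some [f N] is a combination of the earlier
    ones, so it vanishes at [v N]. It serves both for minimal closed sets and for finitely many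
    equations. *)
Lemma no_separating_sequence (f : nat -> {mpoly K[n]}) (v : nat -> 'I_n -> K) :
  (forall N i, (i < N)%N -> (f i).@[v N] = 0) -> ~ forall N, (f N).@[v N] <> 0.
Proof.
move=> fv h; have [N [a fN]] := hilbert_basis f; apply: (h N).
rewrite fN raddf_sum big1 // => i _ /=.
by rewrite mevalM fv ?mulr0.
Qed.

End Noetherian.

(** * The cone over a curve *)

Section ConeOverCurve.
Variables (K : closedFieldType) (r : nat).
Local Notation V := 'rV[K]_r.+1.
Local Notation P := (pspace K r).
Implicit Types (X Y : set P) (H : {vspace V}).

Definition fcoords n : set ('rV[K]_n -> K) := coords id.

Lemma alg_meval n (f : {mpoly K[n]}) : alg (@fcoords n) (fun v => f.@[v 0]).
Proof.
apply: (@alg_ext _ _ _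
  (fun v : 'rV[K]_n => \sum_(m <- msupp f) f@_m * \prod_i v 0 i ^+ m i)).
  by move=> v; rewrite mevalE.
apply: alg_sum => m; apply: alg_mul; first exact: alg_const.
by apply: alg_prod => i; apply/alg_exp/alg_gen; exists i.
Qed.

Lemma alg_mpoly n p : alg (@fcoords n) p ->
  exists f : {mpoly K[n]}, forall v, p v = f.@[v 0].
Proof.
case=> d; elim=> {d p}.
- by move=> _ c; exists c%:MP => v; rewrite mevalC.
- by move=> _ _ [j ->]; exists 'X_j => v; rewrite mevalXU.
- by move=> _ p q _ [f fE] _ [g gE]; exists (f + g) => v; rewrite mevalD fE gE.
- by move=> _ _ p q _ [f fE] _ [g gE]; exists (f * g) => v; rewrite mevalM fE gE.
Qed.

Lemma meval_homog n d (f : {mpoly K[n]}) (c : K) (v : 'rV[K]_n) :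
  f \is d.-homog -> f.@[(c *: v) 0] = c ^+ d * f.@[v 0].
Proof.
move=> /dhomogP hf; rewrite !mevalE mulr_sumr !big_seq; apply: eq_bigr => m mf.
rewrite mulrCA; congr (_ * _).
under eq_bigr do rewrite mxE exprMn.
rewrite big_split /=; congr (_ * _).
by rewrite prodrXr -mdegE (hf m mf).
Qed.

Definition point_of (v : V) (v0 : v != 0) : P.
Proof. by exists <[v]>%VS; rewrite dim_vline v0. Defined.

Lemma pointP (p : P) : exists2 v : V, v != 0 & val p = <[v]>%VS.
Proof.
case: p => L /= /eqP dL; exists (vpick L).
  by rewrite vpick0 -dimv_eq0 dL.
apply/eqP; rewrite eq_sym eqEdim dim_vline vpick0 -dimv_eq0 dL andbT.
by rewrite -memvE memv_pick.
Qed.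

Lemma point_eq (p q : P) : (val p <= val q)%VS -> p = q.
Proof.
by move=> pq; apply/val_inj/eqP; rewrite eqEdim pq (eqP (valP p)) (eqP (valP q)).
Qed.

Lemma vspace_equations H : exists a : 'I_r.+1 -> 'I_r.+1 -> K,
  forall v, v \in H <-> forall j, \sum_i a j i * v 0 i = 0.
Proof.
pose L v := v - projv H v.
have LE v j : L v 0 j = \sum_i L (delta_mx 0 i) 0 j * v 0 i.
  rewrite {1}(row_sum_delta v) /L linear_sum -sumrB summxE; apply: eq_bigr => i _.
  by rewrite linearZ -scalerBr mxE mulrC.
exists (fun j i => L (delta_mx 0 i) 0 j) => v; split=> [vH j|h].
  by rewrite -LE /L projv_id // subrr mxE.
have /eqP : L v = 0 by apply/rowP => j; rewrite LE h mxE.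
by rewrite subr_eq0 => /eqP ->; apply: memv_proj.
Qed.

Lemma plin_closed H : zariski_closed (plin H).
Proof.
have [a ha] := vspace_equations H.
exists [set f | exists j, f = \sum_i a j i *: 'X_i]; split.
  move=> _ [j ->]; exists 1%N; apply: rpred_sum => i _.
  by apply: dhomogZ; rewrite dhomogX /= mdeg1.
apply/seteqP; split=> [p /= pH _ [j ->] v /(subvP pH)/ha/(_ j) <-|p /= hp].
  by rewrite raddf_sum; apply: eq_bigr => i _; rewrite /= mevalZ mevalXU.
apply/subvP => v vp; apply/ha => j.
rewrite -[RHS](hp _ (ex_intro _ j erefl) v vp).
by rewrite raddf_sum; apply: eq_bigr => i _; rewrite /= mevalZ mevalXU.
Qed.

Lemma zariski_closedI X Y :
  zariski_closed X -> zariski_closed Y -> zariski_closed (X `&` Y).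
Proof.
move=> [F [hF ->]] [F' [hF' ->]]; exists (F `|` F'); split.
  by move=> f [/hF|/hF'].
apply/seteqP; split=> [p [h h'] f [/h|/h']|p h] //.
by split=> f Ff; apply: h; [left|right].
Qed.

Lemma vanishesPn (f : {mpoly K[r.+1]}) (p : P) : ~ vanishes_at f p ->
  exists2 v : V, v \in val p & f.@[v 0] <> 0.
Proof. by move=> /existsNP[v /not_implyP[vp fv]]; exists v. Qed.

(** Meant for irreducibility: proper closed subsets of a minimal [Z] are finite, so two of them
    cannot cover it. This replaces the decomposition into irreducible components. *)
Lemma minimal_infinite_closed Y : zariski_closed Y -> ~ finite_pred Y ->
  exists Z, [/\ Z `<=` Y, zariski_closed Z, ~ finite_pred Z &
    forall Z', Z' `<=` Z -> zariski_closed Z' -> ~ finite_pred Z' -> Z' = Z].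
Proof.
move=> cY infY; apply: contrapT => nomin.
pose T := {Z : set P | [/\ Z `<=` Y, zariski_closed Z & ~ finite_pred Z]}.
have /choice[next hnext] (Z : T) :
    exists Z' : T, sval Z' `<=` sval Z /\ sval Z' <> sval Z.
  case: Z => Z [ZY cZ infZ] /=; apply: contrapT => h; apply: nomin.
  exists Z; split=> // Z' Z'Z cZ' infZ'; apply: contrapT => ne; apply: h.
  by exists (exist _ Z' (And3 (subset_trans Z'Z ZY) cZ' infZ')).
pose Z N := iter N next (exist _ Y (And3 (@subset_refl _ Y) cY infY) : T).
have decr i j : (i <= j)%N -> sval (Z j) `<=` sval (Z i).
  elim: j => [|j IH]; first by rewrite leqn0 => /eqP->.
  rewrite leq_eqVlt => /orP[/eqP->//|/IH h].
  by apply: subset_trans h; have [] := hnext (Z j).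
have /choice[fv hfv] N : exists fv : {mpoly K[r.+1]} * V,
    [/\ fv.1.@[fv.2 0] <> 0,
      exists2 p, sval (Z N) p & fv.2 \in val p &
      forall p v, sval (Z N.+1) p -> v \in val p -> fv.1.@[v 0] = 0].
  have [sub ne] := hnext (Z N).
  have [F [_ ZE]] : zariski_closed (sval (Z N.+1)) by case: (Z N.+1) => ? [].
  have [p Zp nZp] : exists2 p, sval (Z N) p & ~ sval (Z N.+1) p.
    apply: contrapT => h; apply: ne; apply/seteqP; split=> // p Zp.
    by apply: contrapT => nZp; apply: h; exists p.
  have [f Ff /vanishesPn[v vp fv]] : exists2 f, F f & ~ vanishes_at f p.
    apply: contrapT => h; apply: nZp; rewrite ZE => f Ff.
    by apply: contrapT => nf; apply: h; exists f.
  exists (f, v); split=> //; first by exists p.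
  by move=> q w; rewrite ZE => /(_ _ Ff); apply.
apply: (@no_separating_sequence _ _ (fun N => (fv N).1) (fun N => (fv N).2 0)).
  move=> N i iN; have [_ [p Zp vp] _] := hfv N; have [_ _ h] := hfv i.
  by apply: h vp; apply: decr Zp.
by move=> N; have [] := hfv N.
Qed.

Lemma dim_full n : \dim (fullv : {vspace 'rV[K]_n}) = n.
Proof. by rewrite dimvf /dim /= mul1n. Qed.

Lemma dim_lt_full n (U : {vspace 'rV[K]_n}) : U != fullv -> (\dim U < n)%N.
Proof.
move=> nf; have : (\dim U < \dim (fullv : {vspace 'rV[K]_n}))%N.
  rewrite ltn_neqAle dimvS ?subvf // andbT; apply: contra nf => /eqP E.
  by rewrite eqEdim subvf E /=.
by rewrite dim_full.
Qed.

Lemma proper_sub_hyperplane H : H != fullv ->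
  exists2 H', (H <= H')%VS & \dim H' = r.
Proof.
move: {2}(r - \dim H)%N (leqnn (r - \dim H)) => k; elim: k H => [|k IH] H.
  by move=> dH /dim_lt_full nf; exists H => //; lia.
move=> dH nf.
have [v vH] : exists v, v \notin H.
  apply: contrapT => h; move/eqP: nf; apply; apply/eqP.
  rewrite eqEsubv subvf; apply/subvP => v _; apply: contrapT => /negP nv.
  by apply: h; exists v.
have [dHr|dHr] := eqVneq (\dim H) r; first by exists H.
have dH' := dim_lt_full nf.
have d1 : (\dim (H + <[v]>) <= (\dim H).+1)%N.
  apply: leq_trans (dimv_add_leqif _ _) _.
  by rewrite dim_vline; case: (v != 0); lia.
have d2 : (\dim H < \dim (H + <[v]>))%N.
  rewrite ltn_neqAle dimvS ?addvSl // andbT; apply: contra vH => /eqP E.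
  have -> : H = (H + <[v]>)%VS by apply/eqP; rewrite eqEdim addvSl E /=.
  by rewrite memvE addvSr.
have [||H' HH' dH''] := IH (H + <[v]>)%VS.
- by lia.
- by apply/eqP => E; move: d1; rewrite E dim_full; move/eqP: dHr; lia.
by exists H' => //; apply: subv_trans HH'; apply: addvSl.
Qed.

Lemma set1_closed (p : P) : zariski_closed [set p].
Proof.
rewrite (_ : [set p] = plin (val p)); first exact: plin_closed.
by apply/seteqP; split=> [_ ->|q /point_eq->]; rewrite /plin /=.
Qed.

Lemma set1_irreducible (p : P) : irreducible_set [set p].
Proof.
split; first by exists p.
move=> A B _ _ /(_ p erefl)[Ap|Bp]; by [left=> _ ->|right=> _ ->].
Qed.

(** An infinite section would contain an infinite irreducible closed [Z]; a point of [Z], [Z] and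
    [X] would then form a chain of length 2, where [Z] differs from [X] by non-degeneracy. *)
Lemma curve_section_finite X H : integral_curve X -> nondegenerate_set X ->
  H != fullv -> finite_pred (fun p => X p /\ (val p <= H)%VS).
Proof.
move=> [cX irrX [_ nochain]] ndX /proper_sub_hyperplane[H' HH' dH'].
suff [s hs] : finite_pred (X `&` plin H').
  by exists s => p [Xp pH]; apply: hs; split=> //; apply: subv_trans pH HH'.
apply: contrapT => inf.
have cXH : zariski_closed (X `&` plin H') by apply/zariski_closedI/plin_closed.
have [Z [ZXH cZ infZ minZ]] := minimal_infinite_closed cXH inf.
have [p Zp] : exists p, Z p.
  by apply: contrapT => h; apply: infZ; exists [::] => p Zp; case: h; exists p.
have irrZ : irreducible_set Z.
  split=> [|A B cA cB ZAB]; first by exists p.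
  apply: contrapT => /not_orP[nA nB]; apply: infZ.
  have fin A' : zariski_closed A' -> ~ Z `<=` A' -> finite_pred (Z `&` A').
    move=> cA' nA'; apply: contrapT => infA; apply: nA'.
    have <- : Z `&` A' = Z.
      by apply: minZ => //; apply: zariski_closedI.
    by move=> q [].
  have [s hs] := fin A cA nA; have [t ht] := fin B cB nB.
  exists (s ++ t) => q Zq; rewrite mem_cat.
  by case: (ZAB q Zq) => ?; [rewrite hs|rewrite ht ?orbT].
apply: nochain; exists (fun i => if i is i'.+1 then if i' is _.+1 then X else Z
  else [set p]); split.
  case=> [|[|i]] _; split=> //; try exact: set1_closed; try exact: set1_irreducible.
  - by move=> _ ->; have [] := ZXH p Zp.
  - by move=> q /ZXH[].
case=> [|[|i]] // _; split.
- by move=> _ ->.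
- move=> Zp1; apply: infZ; exists [:: p] => q /Zp1 ->; exact: mem_head.
- by move=> q /ZXH[].
- by move=> XZ; apply: (ndX H' dH') => q /XZ/ZXH[].
Qed.

Definition cone X : set V := [set v | v = 0 \/ exists2 p, X p & v \in val p].

Lemma coneZ X c v : cone X v -> cone X (c *: v).
Proof.
case=> [->|[p Xp vp]]; first by left; rewrite scaler0.
by right; exists p => //; apply: memvZ.
Qed.

Lemma cone_point X v (v0 : v != 0) : cone X v -> X (point_of v0).
Proof.
case=> [E|[p Xp vp]]; first by case/negP: (v0); rewrite E.
by rewrite (_ : point_of v0 = p) //; apply: point_eq; rewrite /= -memvE.
Qed.

Lemma closed_finite X : zariski_closed X -> exists fs : seq {mpoly K[r.+1]},
  [/\ forall f, List.In f fs -> exists d : nat, f \is d.-homog &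
    X = [set p | forall f, List.In f fs -> vanishes_at f p]].
Proof.
move=> [F [hF ->]]; apply: contrapT => nofin.
pose T := {fs : seq {mpoly K[r.+1]} | forall f, List.In f fs -> F f}.
have /choice[nx hnx] (fs : T) : exists fv : {mpoly K[r.+1]} * V,
    [/\ F fv.1, fv.1.@[fv.2 0] <> 0 &
      forall f, List.In f (sval fs) -> f.@[fv.2 0] = 0].
  case: fs => fs fsF /=; apply: contrapT => h; apply: nofin; exists fs; split.
    by move=> f /fsF/hF.
  apply/seteqP; split=> p /= hp f Ff; first exact/hp/fsF.
  apply: contrapT => /vanishesPn[v vp fv]; apply: h; exists (f, v).
  by split=> // g /hp; apply.
have stepP (fs : T) f : List.In f ((nx fs).1 :: sval fs) -> F f.
  by case: fs f => fs fsF f /= [<-|/fsF //]; have [] := hnx (exist _ fs fsF).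
have nilP f : List.In f ([::] : seq {mpoly K[r.+1]}) -> F f by [].
pose fs N : T := iter N (fun fs : T => exist _ ((nx fs).1 :: sval fs) (stepP fs) : T)
  (exist _ [::] nilP).
have fs_in N i : (i < N)%N -> List.In (nx (fs i)).1 (sval (fs N)).
  elim: N => // N IH; rewrite ltnS leq_eqVlt => /orP[/eqP->|/IH]; by [left|right].
apply: (@no_separating_sequence _ _ (fun N => (nx (fs N)).1)
  (fun N => (nx (fs N)).2 0)).
  by move=> N i /fs_in h; have [_ _] := hnx (fs N); apply.
by move=> N; have [] := hnx (fs N).
Qed.

Lemma cone_constr X : zariski_closed X -> constr (@fcoords r.+1) (cone X).
Proof.
move=> /closed_finite[fs [hfs XE]].
pose Q (v : V) := forall f, List.In f fs -> f.@[v 0] = 0.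
apply: (@constr_ext _ _ _ (fun v => v = 0 \/ Q v)).
  move=> v; split=> [[->|Qv]|[->|[p Xp vp]]]; try by left.
    have [->|v0] := eqVneq v 0; first by left.
    right; exists (point_of v0); last by rewrite memvE.
    rewrite XE => f ffs w /vlineP[c ->].
    by have [d hd] := hfs f ffs; rewrite (meval_homog _ _ hd) Qv // mulr0.
  by right=> f ffs; move: Xp; rewrite XE => /(_ f ffs); apply.
apply: constr_or.
  apply: constr_eq_row => j; first by apply: alg_gen; exists j.
  by apply: (@alg_ext _ _ _ (fun=> 0)) => [v|]; [rewrite mxE|apply: alg_const].
rewrite /Q; elim: (fs) => [|f s IH].
  by apply: (@constr_ext _ _ _ (fun=> True)) => //; apply: constr_const.
apply: (@constr_ext _ _ _ (fun v : V => f.@[v 0] = 0 /\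
    forall f : {mpoly K[r.+1]}, List.In f s -> f.@[v 0] = 0)).
  move=> v; split=> [[h1 h2] g /= [<-|/h2]|h] //.
  by split=> [|g gs]; apply: h; [left|right].
by apply: ConstrAnd => //; apply/ConstrZero/alg_meval.
Qed.

(** On the line through [u], [p] is a polynomial in [t] whose coefficients are the values at [u] of
    its homogeneous components. A condition [p <> 0] on vectors thus becomes a condition [f <> 0] on
    points, at the price of rescaling the representative. *)
Lemma homog_component (p : V -> K) (v : V) : alg (@fcoords r.+1) p -> p v != 0 ->
  exists d (f : {mpoly K[r.+1]}), [/\ f \is d.-homog, f.@[v 0] != 0 &
    forall u : V, f.@[u 0] != 0 -> exists2 q : {poly K}, q != 0 &
      forall t, q.[t] = p (t *: u)].
Proof.
move=> /alg_mpoly[g gE] pv; pose k := msize g.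
have gS : g = \sum_(d < k) pihomog mdeg d g.
  by apply: pihomog_partitionE; rewrite leqnn.
have pE u : p u = \sum_(d < k) (pihomog mdeg d g).@[u 0].
  by rewrite gE {1}gS raddf_sum.
have [d fd] : exists d : 'I_k, (pihomog mdeg d g).@[v 0] != 0.
  apply: contrapT => h; move/eqP: pv; apply; rewrite pE big1 // => d _.
  by apply: contrapT => /eqP fd; apply: h; exists d.
exists d, (pihomog mdeg d g); split=> // [|u fu]; first exact: pihomogP.
exists (\poly_(i < k) (pihomog mdeg i g).@[u 0]).
  apply/eqP => /(congr1 (fun q : {poly K} => q`_d)); rewrite coef_poly ltn_ord coef0.
  exact/eqP.
move=> t; rewrite horner_poly pE; apply: eq_bigr => i _.
by rewrite (meval_homog _ _ (pihomogP _ _ _)) mulrC.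
Qed.

(** Irreducibility of [X] concerns forms only. Homogeneous components of [p] and [q] are both
    nonzero at some [w] of the cone, and then [p] and [q] are both nonzero at a suitable multiple of
    [w]. *)
Lemma cone_prime X : irreducible_set X -> prime_set (cone X) (@fcoords r.+1).
Proof.
move=> [[p0 Xp0] irrX]; split; first by exists 0; left.
move=> p q ap aq pq; apply: contrapT => /not_orP[].
move=> /existsNP[u /not_implyP[Cu /eqP pu]] /existsNP[v /not_implyP[Cv /eqP qv]].
have [d [f [hf fu fp]]] := homog_component ap pu.
have [e [g [hg gv gq]]] := homog_component aq qv.
have closed_f k (h : {mpoly K[r.+1]}) : h \is k.-homog ->
    zariski_closed [set x | vanishes_at h x].
  move=> hh; exists [set h]; split; first by move=> _ ->; exists k.
  by apply/seteqP; split=> [x hx _ ->|x /(_ h erefl)].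
have [w Cw [fw gw]] : exists2 w, cone X w & f.@[w 0] != 0 /\ g.@[w 0] != 0.
  have nonv k (h : {mpoly K[r.+1]}) w : h \is k.-homog -> cone X w ->
      h.@[w 0] != 0 -> ~ X `<=` [set x | vanishes_at h x].
    move=> hh [->|[x Xx wx]] hw Xh; last by move/eqP: hw; apply; apply: (Xh x).
    (* The case [w = 0]: a form that vanishes at some vector [y] also vanishes at [0 *: y]. *)
    have [y y0 yE] := pointP p0; move/eqP: hw; apply.
    have -> : (0 : V) = 0 *: y by rewrite scale0r.
    rewrite (meval_homog _ _ hh).
    by rewrite (Xh p0 Xp0 y) ?mulr0 // yE memv_line.
  apply: contrapT => h.
  have : X `<=` [set x | vanishes_at f x] `|` [set x | vanishes_at g x].
    move=> x Xx; apply: contrapT => /not_orP[/vanishesPn[w wx fw] /vanishesPn[w' w'x gw']].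
    have [y y0 yE] := pointP x.
    apply: h; exists y; first by right; exists x => //; rewrite yE memv_line.
    move: wx w'x; rewrite yE => /vlineP[c wE] /vlineP[c' wE'].
    move: fw gw'; rewrite wE wE' (meval_homog _ _ hf) (meval_homog _ _ hg).
    by move=> /eqP; rewrite mulf_eq0 negb_or => /andP[_ ?] /eqP;
      rewrite mulf_eq0 negb_or => /andP[_ ?].
  by case/(irrX _ _ (closed_f _ _ hf) (closed_f _ _ hg));
    [apply: nonv hf Cu fu|apply: nonv hg Cv gv].
have [fp' fp0 fpE] := fp w fw; have [gq' gq0 gqE] := gq w gw.
have [t] := poly_nonroot (mulf_neq0 fp0 gq0).
by rewrite hornerM fpE gqE pq ?eqxx //; apply: coneZ.
Qed.

End ConeOverCurve.

(** * Dimension counts *)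

Lemma In_nth_lt (T : Type) (x0 : T) s i :
  (i < size s)%N -> List.In (nth x0 s i) s.
Proof.
elim: s i => [//|x s IH] [|i] /= h; first by left.
by right; apply: IH.
Qed.

Section Spans.
Variables (K : closedFieldType) (r : nat).
Local Notation V := 'rV[K]_r.+1.
Variable Om : Type.
Implicit Types (G : set (Om -> K)) (us : seq (Om -> V)).

Definition spans us w : {vspace V} := <<[seq u w | u <- us]>>%VS.

Lemma mem_spans us w v : v \in spans us w <->
  exists l : 'rV[K]_(size us), v = \sum_i l 0 i *: nth (fun=> 0) us i w.
Proof.
rewrite /spans; split.
  pose s := in_tuple [seq u w | u <- us]; move=> /(coord_span (X := s)) vE.
  have sz : size us = size [seq u w | u <- us] by rewrite size_map.
  exists (\row_i coord s (cast_ord sz i) v); rewrite {1}vE.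
  rewrite (reindex (cast_ord sz)); last first.
    by apply: onW_bij; exists (cast_ord (esym sz)) => i; apply: val_inj.
  by apply: eq_bigr => i _; rewrite mxE /= (nth_map (fun=> 0)).
move=> [l ->]; apply: memv_suml => i _; apply/memvZ/memv_span.
have -> : nth (fun=> 0) us i w = nth 0 [seq u w | u <- us] i.
  by rewrite (nth_map (fun=> 0)).
by apply: mem_nth; rewrite size_map.
Qed.

Lemma constr_spans G us (t : Om -> V) :
  (forall u, List.In u us -> forall j, alg G (fun w => u w 0 j)) ->
  (forall j, alg G (fun w => t w 0 j)) ->
  constr G (fun w => t w \in spans us w).
Proof.
move=> au at_.
apply: (@constr_ext _ _ _ (fun w => exists l : 'rV[K]_(size us),
    t w = \sum_i l 0 i *: nth (fun=> 0) us i w)).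
  by move=> w; rewrite mem_spans.
apply: (@constr_proj _ _ _ _ (fun x : Om * 'rV[K]_(size us) =>
   t x.1 = \sum_i x.2 0 i *: nth (fun=> 0) us i x.1)).
have lift g : alg G g -> alg (ext (n := size us) G) (g \o fst).
  by apply: alg_comp => h Gh; apply: alg_gen; left; exists h.
apply: constr_eq_row => j; first exact: lift (at_ j).
apply: (@alg_ext _ _ _ (fun x : Om * 'rV[K]_(size us) =>
    \sum_i x.2 0 i * nth (fun=> 0) us i x.1 0 j)).
  by move=> x; rewrite summxE; apply: eq_bigr => i _; rewrite mxE.
apply: alg_sum => i; apply: alg_mul; first exact: coords_ext.
apply: (lift (fun w => nth (fun=> 0) us i w 0 j)); apply: au.
exact: In_nth_lt.
Qed.

End Spans.

Lemma constr_spans_snd (K : closedFieldType) r (Om : Type) (G : set (Om -> K))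
    (us : seq (Om -> 'rV[K]_r.+1)) :
  (forall u, List.In u us -> forall j, alg G (fun w => u w 0 j)) ->
  constr (ext (n := r.+1) G) (fun x => x.2 \in spans us x.1).
Proof.
move=> au; pose fs := [seq (fun x : Om * 'rV[K]_r.+1 => u x.1) | u <- us].
apply: (@constr_ext _ _ _ (fun x : Om * 'rV[K]_r.+1 => x.2 \in spans fs x)).
  by move=> x; rewrite /spans /fs -map_comp.
apply: constr_spans => [f /List.in_map_iff[u [<- usu]] j|j].
  by apply: alg_comp (au u usu j) => g Gg; apply: alg_gen; left; exists g.
exact: coords_ext.
Qed.

Section DimensionCounts.
Variables (K : closedFieldType) (r : nat) (X : set (pspace K r)).
Hypothesis r_gt0 : (0 < r)%N.
Hypothesis finX : forall H : {vspace 'rV[K]_r.+1}, H != fullv ->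
  finite_pred (fun p => X p /\ (val p <= H)%VS).
Hypothesis closedX : zariski_closed X.
Local Notation V := 'rV[K]_r.+1.

(** Each point of [X] has at least one and only finitely many such representatives, so the scaling
    of the cone costs no parameter. *)
Definition normalized (v : V) : Prop := cone X v /\ exists i, v 0 i = 1.

Lemma form_kernel (a : 'cV[K]_r.+1) :
  exists H : {vspace V}, forall v, (v \in H) = (v *m a == 0).
Proof.
exists (lker (linfun (mulmxr a : {linear V -> 'rV[K]_1}))) => v.
by rewrite memv_ker lfunE.
Qed.

Lemma normalized_finite (H : {vspace V}) : H != fullv ->
  finite_pred (fun v => normalized v /\ v \in H).
Proof.
move=> /finX[s hs]; pose u (p : pspace K r) := vpick (val p).
exists [seq (u p 0 i)^-1 *: u p | p <- s, i <- enum 'I_r.+1] => v [[Cv [i vi]] vH].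
have v0 : v != 0 by apply/eqP => E; move/eqP: vi; rewrite E mxE eq_sym oner_eq0.
apply/allpairsP; exists (point_of v0, i); split=> /=.
- by apply: hs; split; [apply: cone_point|rewrite /= -memvE].
- by rewrite mem_enum.
have /vlineP[c E] : u (point_of v0) \in <[v]>%VS by apply: memv_pick.
rewrite E mxE vi mulr1 scalerA mulVf ?scale1r //.
apply/eqP => c0; have : vpick <[v]>%VS != 0 by rewrite vpick0 -dimv_eq0 dim_vline v0.
by rewrite -[vpick _]/(u (point_of v0)) E c0 scale0r eqxx.
Qed.

Lemma normalized_scale (v : V) : cone X v -> v != 0 ->
  exists2 c, c != 0 & normalized (c *: v).
Proof.
move=> Cv v0; have [i vi] : exists i, v 0 i != 0.
  apply: contrapT => h; move/eqP: v0; apply; apply/rowP => i; rewrite mxE.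
  by apply: contrapT => /eqP vi; apply: h; exists i.
exists (v 0 i)^-1; first by rewrite invr_eq0.
by split; [apply: coneZ|exists i; rewrite mxE mulVf].
Qed.

Section Counts.
Variable Om : Type.
Implicit Types (Z : set Om) (G : set (Om -> K)) (us ts : seq (Om -> V)).

(** Where [t_i = 1], another coordinate [c = t_i'] serves as the parameter: fixing it puts [t] in
    the hyperplane [x_i' = c x_i], which contains finitely many normalized vectors. *)
Lemma dim_le_curve Z G m (t : Om -> V) : (forall w, Z w -> normalized (t w)) ->
  dim_le Z G m -> dim_le Z (G `|` coords t) m.+1.
Proof.
move=> nt dZ.
apply: (@dim_le_sub _ _ [set w | exists i, Z w /\ t w 0 i = 1]).
  by move=> w Zw; have [_ [i ti]] := nt w Zw; exists i.
apply: dim_le_bigcup => i.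
have [i' ii'] : exists i' : 'I_r.+1, i' != i.
  have [->|i0] := eqVneq i 0; last by exists 0; rewrite eq_sym.
  by exists (Ordinal (r_gt0 : 1 < r.+1)%N).
pose c w := t w 0 i'.
pose Pf (x : Om * V) := cone X x.2 /\ x.2 0 i = 1 /\ x.2 0 i' = c x.1.
apply: (@dim_le_gen _ _ _ ((G `|` [set c]) `|` coords t)).
  by move=> g [Gg|tg]; [left; left|right].
have dZi : dim_le [set w | Z w /\ t w 0 i = 1] G m by apply: dim_le_sub dZ => w [].
apply: (@dim_le_fiber _ _ _ _ _ _ _ Pf).
- have cV (j : 'I_r.+1) : alg (ext (n := r.+1) (G `|` [set c]))
      (fun x : Om * V => x.2 0 j) by apply: coords_ext.
  apply: ConstrAnd; last apply: ConstrAnd.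
  + by apply: (constr_comp (f := snd)) (cone_constr closedX) => _ [j ->]; apply: cV.
  + by apply: constr_eq (alg_const _ 1); apply: cV.
  + by apply: constr_eq; [apply: cV|apply: alg_gen; left; exists c => //; right].
- by move=> w [Zw ti]; have [] := nt w Zw.
- move=> w [Zw ti]; pose a : 'cV[K]_r.+1 := delta_mx i' 0 - c w *: delta_mx i 0.
  have [H HE] := form_kernel a.
  have aE v : (v *m a) 0 0 = v 0 i' - c w * v 0 i.
    by rewrite mulmxBr -scalemxAr -!colE !mxE.
  have [s hs] : finite_pred (fun v => normalized v /\ v \in H).
    apply: normalized_finite; apply/eqP => E.
    have : delta_mx 0 i' \in H by rewrite E memvf.
    rewrite HE => /eqP/(congr1 (fun N : 'M[K]_1 => N 0 0)).
    rewrite aE !mxE !eqxx (negPf (_ : i != i')) 1?eq_sym // mulr0 subr0.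
    by move/eqP; rewrite oner_eq0.
  exists s => v [Cv [vi vi']]; apply: hs; split; first by split=> //; exists i.
  rewrite HE; apply/eqP/rowP => k; rewrite !ord1 aE mxE.
  by move: vi vi' => /= -> ->; rewrite mulr1 subrr.
- by rewrite -[m.+1]addn1; apply: dim_le_join => //; apply: dim_le_set1.
Qed.

(** At most [r] vectors span a proper subspace, which contains finitely many normalized vectors;
    hence [t] costs no parameter. *)
Lemma dim_le_curve_span Z G m us (t : Om -> V) : (size us <= r)%N ->
  (forall u, List.In u us -> forall j, alg G (fun w => u w 0 j)) ->
  (forall w, Z w -> normalized (t w) /\ t w \in spans us w) ->
  dim_le Z G m -> dim_le Z (G `|` coords t) m.
Proof.
move=> us_r au nt.
pose Pf (x : Om * V) := normalized x.2 /\ x.2 \in spans us x.1.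
apply: (@dim_le_fiber _ _ _ _ _ _ _ Pf) => //.
  have cV (j : 'I_r.+1) : alg (ext (n := r.+1) G) (fun x : Om * V => x.2 0 j).
    exact: coords_ext.
  apply: ConstrAnd.
    apply: ConstrAnd.
      by apply: (constr_comp (f := snd)) (cone_constr closedX) => _ [j ->]; apply: cV.
    by apply: constr_exists => i; apply: constr_eq (alg_const _ 1); apply: cV.
  exact: constr_spans_snd.
move=> w Zw; apply: (@normalized_finite (spans us w)); apply/eqP => E.
have := dim_span [seq u w | u <- us]; rewrite -/(spans us w) E dim_full size_map.
by lia.
Qed.

Definition all_coords ts : set (Om -> K) :=
  [set c | exists t, List.In t ts /\ exists j, c = fun w => t w 0 j].

Lemma all_coords_alg G ts t j : List.In t ts ->
  alg (G `|` all_coords ts) (fun w => t w 0 j).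
Proof. by move=> tts; apply: alg_gen; right; exists t; split=> //; exists j. Qed.

Lemma all_coords_cons G t ts : G `|` all_coords (t :: ts) `<=`
  G `|` coords t `|` all_coords ts.
Proof.
move=> c [Gc|[t' [[<-|h] [j ->]]]]; first by left; left.
  by left; right; exists j.
by right; exists t'; split=> //; exists j.
Qed.

Lemma dim_le_curves Z G m ts : (forall t, List.In t ts -> forall w, Z w ->
    normalized (t w)) ->
  dim_le Z G m -> dim_le Z (G `|` all_coords ts) (m + size ts).
Proof.
elim: ts G m => [|t ts IH] G m nt dZ /=.
  by rewrite addn0; apply: dim_le_gen dZ => c [//|[t []]].
rewrite addnS -addSn; apply: dim_le_gen (@all_coords_cons G t ts) _.
apply: IH => [t' h|]; first by apply: nt; right.
by apply: dim_le_curve => //; apply: nt; left.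
Qed.

Lemma dim_le_curves_span Z G m us ts : (size us <= r)%N ->
  (forall u, List.In u us -> forall j, alg G (fun w => u w 0 j)) ->
  (forall t, List.In t ts -> forall w, Z w ->
    normalized (t w) /\ t w \in spans us w) ->
  dim_le Z G m -> dim_le Z (G `|` all_coords ts) m.
Proof.
move=> us_r; elim: ts G => [|t ts IH] G au nt dZ /=.
  by apply: dim_le_gen dZ => c [//|[t []]].
apply: dim_le_gen (@all_coords_cons G t ts) _.
apply: IH => [u usu j|t' h|].
- by apply: alg_subset (au u usu j) => c; left.
- by apply: nt; right.
by apply: (dim_le_curve_span us_r au) => //; apply: nt; left.
Qed.

Lemma coordinates_separate e (U : {vspace V}) : (\dim U <= e)%N ->
  exists f : {ffun 'I_e -> 'I_r.+1}, forall v, v \in U ->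
    (forall k, v 0 (f k) = 0) -> v = 0.
Proof.
elim: e U => [|e IH] U dU.
  exists [ffun=> ord0] => v; move: dU; rewrite leqn0 dimv_eq0 => /eqP->.
  by rewrite memv0 => /eqP.
have [->|U0] := eqVneq U 0%VS.
  by exists [ffun=> ord0] => v; rewrite memv0 => /eqP.
have [j vj] : exists j, vpick U 0 j != 0.
  apply: contrapT => h; move: U0; rewrite -vpick0 => /eqP; apply; apply/rowP => j.
  by rewrite mxE; apply: contrapT => /eqP vj; apply: h; exists j.
have [H HE] := form_kernel (delta_mx j 0).
have HvE v : (v \in H) = (v 0 j == 0).
  rewrite HE -colE; apply/eqP/eqP => [/colP/(_ 0)|E]; first by rewrite !mxE.
  by apply/rowP => k; rewrite ord1 !mxE.
have dUH : (\dim (U :&: H) <= e)%N.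
  rewrite -ltnS; apply: leq_trans dU; rewrite ltn_neqAle dimvS ?capvSl // andbT.
  apply: contra vj => /eqP E; rewrite -HvE.
  have -> : U = (U :&: H)%VS by apply/eqP; rewrite eq_sym eqEdim capvSl E /=.
  by move: (memv_pick (U :&: H)); rewrite memv_cap => /andP[].
have [f hf] := IH _ dUH.
exists [ffun k => oapp f j (unlift ord_max k)] => v vU vf; apply: hf.
  rewrite memv_cap vU HvE; apply/eqP.
  by have := vf ord_max; rewrite ffunE unlift_none.
by move=> k; have := vf (lift ord_max k); rewrite ffunE liftK.
Qed.

Lemma dim_le_coords Z e (q : Om -> 'rV[K]_e) : dim_le Z (coords q) e.
Proof.
suff key (s : seq 'I_e) :
    dim_le Z [set c | exists2 j, j \in s & c = fun w => q w 0 j] (size s).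
  have := key (enum 'I_e); rewrite -cardE card_ord; apply: dim_le_gen.
  by move=> _ [j ->]; exists j; rewrite ?mem_enum.
elim: s => [|j s IH] /=; first by apply: dim_le_gen (@dim_le_set0 K Om Z) => c [j].
have := dim_le_join IH (dim_le_set1 Z (fun w => q w 0 j)); rewrite addn1.
apply: dim_le_gen.
move=> c [i]; rewrite inE => /orP[/eqP->|si] ->; [by right|by left; exists i].
Qed.

(** A vector of a subspace of dimension at most [e] is determined by [e] well-chosen coordinates.
    The choice depends on the subspace, whence a finite union over the choices [f]. *)
Lemma dim_le_subspace Z G m e (U : Om -> {vspace V}) (q : Om -> V) :
  constr (ext (n := r.+1) G) (fun x => x.2 \in U x.1) ->
  (forall w, Z w -> (\dim (U w) <= e)%N /\ q w \in U w) ->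
  dim_le Z G m -> dim_le Z (G `|` coords q) (m + e).
Proof.
move=> cU hU dZ.
pose Zf (f : {ffun 'I_e -> 'I_r.+1}) w := Z w /\
  forall v, v \in U w -> (forall k, v 0 (f k) = 0) -> v = 0.
apply: (@dim_le_sub _ _ [set w | exists f, Zf f w]).
  by move=> w Zw; have [/coordinates_separate[f hf] _] := hU w Zw; exists f.
apply: dim_le_bigcup => f; pose qf w := \row_k q w 0 (f k).
apply: (@dim_le_gen _ _ _ ((G `|` coords qf) `|` coords q)).
  by move=> c [Gc|qc]; [left; left|right].
have dZf : dim_le (Zf f) G m by apply: dim_le_sub dZ => w [].
apply: (@dim_le_fiber _ _ _ _ _ _ _
  (fun x : Om * V => x.2 \in U x.1 /\ forall k, x.2 0 (f k) = qf x.1 0 k)).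
- apply: ConstrAnd.
    by apply: constr_subset cU => _ [[g Gg ->]|[j ->]];
      [left; exists g => //; left|right; exists j].
  apply: constr_forall => k; apply: constr_eq; first exact: coords_ext.
  apply: alg_gen; left; exists (fun w => qf w 0 k) => //; right; by exists k.
- by move=> w [Zw _]; split=> [|k]; [have [] := hU w Zw|rewrite mxE].
- move=> w [Zw inj]; exists [:: q w] => v [/= vU vq]; rewrite inE -subr_eq0.
  apply/eqP/inj; first by apply: rpredB => //; have [] := hU w Zw.
  by move=> k; rewrite !mxE vq mxE subrr.
- by apply: dim_le_join dZf _; apply: dim_le_coords.
Qed.

End Counts.
End DimensionCounts.

(** * Sums of points of the cone and pairs of decompositions *)

Section SumsAndPairs.
Variables (K : closedFieldType) (r : nat) (X : set (pspace K r)).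
Hypothesis r_gt0 : (0 < r)%N.
Hypothesis finX : forall H : {vspace 'rV[K]_r.+1}, H != fullv ->
  finite_pred (fun p => X p /\ (val p <= H)%VS).
Hypothesis closedX : zariski_closed X.
Hypothesis X0 : X !=set0.
Local Notation V := 'rV[K]_r.+1.

Fixpoint sums k : set V :=
  if k is k'.+1 then [set q | exists2 v, cone X v & sums k' (q - v)] else [set 0].

Lemma normalized_exists : exists t : V, normalized X t.
Proof.
have [p Xp] := X0; have [v v0 pE] := pointP p.
have [|c _ nc] := @normalized_scale _ _ X v _ v0; last by exists (c *: v).
by right; exists p => //; rewrite pE memv_line.
Qed.

Lemma cone_normalized v : cone X v -> exists2 t, normalized X t & v \in <[t]>%VS.
Proof.
move=> Cv; have [->|v0] := eqVneq v 0.
  by have [t nt] := normalized_exists; exists t; rewrite ?mem0v.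
have [c c0 nc] := normalized_scale Cv v0; exists (c *: v) => //.
by apply/vlineP; exists c^-1; rewrite scalerA mulVf ?scale1r.
Qed.

Lemma sums_normalized k q : sums k q -> exists ts : seq V,
  [/\ size ts = k, forall t, t \in ts -> normalized X t & q \in <<ts>>%VS].
Proof.
elim: k q => [|k IH] q /=; first by move=> ->; exists [::]; rewrite mem0v.
move=> [v /cone_normalized[t nt vt] /IH[ts [sz nts qts]]]; exists (t :: ts).
split=> [|t'|]; first by rewrite /= sz.
  by rewrite inE => /orP[/eqP->|/nts].
by rewrite span_cons -[q](subrK v) addrC memv_add.
Qed.

Lemma span_sums ts q : (forall t, t \in ts -> cone X t) -> q \in <<ts>>%VS ->
  sums (size ts) q.
Proof.
elim: ts q => [|t ts IH] q nts; first by rewrite span_nil memv0 => /eqP.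
rewrite span_cons => /memv_addP[u /vlineP[c ->] [v vts ->]] /=.
exists (c *: t); first by apply/coneZ/nts/mem_head.
by rewrite addrC addKr; apply: IH => // t' h; apply: nts; rewrite inE h orbT.
Qed.

Lemma sums_mono j k q : (j <= k)%N -> sums j q -> sums k q.
Proof.
elim: k => [|k IH]; first by rewrite leqn0 => /eqP->.
rewrite leq_eqVlt => /orP[/eqP->//|/IH h] /h kq; exists 0; last by rewrite subr0.
by left.
Qed.

(** A pair in [seq V * V] is a list of vectors of the cone with a vector to be expressed through
    them. *)
Definition entry (i : nat) (w : seq V * V) : V := nth 0 w.1 i.

Lemma spans_entries (w : seq V * V) m k :
  spans [seq entry i | i <- iota m k] w = <<[seq nth 0%R w.1 i | i <- iota m k]>>%VS.
Proof. by rewrite /spans -map_comp. Qed.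

Lemma dim_le_pullback (Z : set (seq V * V)) (Y : set V) G m :
  (forall q, Y q -> exists ts, Z (ts, q)) ->
  dim_le Z (G `|` coords snd) m -> dim_le Y (@fcoords K r.+1) m.
Proof.
move=> YZ dZ.
have /dim_le_image dI : dim_le Z (pull snd (@fcoords K r.+1)) m.
  by apply: dim_le_gen dZ => _ [_ [j ->] ->]; right; exists j.
by apply: dim_le_sub dI => q /YZ[ts Zq]; exists (ts, q).
Qed.

Lemma In_entries i m k : (m <= i < m + k)%N ->
  List.In (entry i) [seq entry i | i <- iota m k].
Proof.
move=> h; apply: List.in_map; have : i \in iota m k by rewrite mem_iota.
by elim: (iota m k) => // j s IH; rewrite inE => /orP[/eqP->|/IH]; [left|right].
Qed.

Lemma entries_In t s : List.In t [seq entry i | i <- s] ->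
  exists2 i, i \in s & t = entry i.
Proof.
elim: s => //= i s IH [<-|/IH[j js ->]]; first by exists i; rewrite ?mem_head.
by exists j; rewrite // inE js orbT.
Qed.

(** The [k] normalized vectors cost one parameter each, and a vector of their span costs [k]
    more. *)
Lemma dim_le_sums k : dim_le (sums k) (@fcoords K r.+1) (k + k).
Proof.
pose Z : set (seq V * V) := [set w | [/\ size w.1 = k,
  forall t, t \in w.1 -> normalized X t & w.2 \in <<w.1>>%VS]].
pose ts := [seq entry i | i <- iota 0 k].
have tsE w : Z w -> spans ts w = <<w.1>>%VS.
  by move=> [sz _ _]; rewrite /ts spans_entries -sz map_nth_iota0 ?take_size.
apply: (@dim_le_pullback Z _ (set0 `|` all_coords ts)).
  by move=> q /sums_normalized[s [sz ns qs]]; exists s.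
apply: (@dim_le_subspace _ _ _ _ _ _ _ (spans ts)).
- by apply: constr_spans_snd => u uts j; apply: all_coords_alg.
- move=> w Zw; rewrite tsE //; case: Zw => sz _ ?; split=> //.
  by rewrite -sz; apply: dim_span.
have := @dim_le_curves _ _ _ r_gt0 finX closedX _ Z set0 0 ts.
rewrite size_map size_iota; apply=> [t /entries_In[i]|]; last exact: dim_le_set0.
by rewrite mem_iota => ik -> w [sz nt _]; apply/nt/mem_nth; rewrite sz.
Qed.

(* The points with two decompositions, through x and through y, whose spans may
   meet in more than one point. *)
Definition bad k (x y : V) : set V := [set q | exists ts ts' : seq V,
  [/\ size ts = k /\ size ts' = k,
      forall t, t \in ts ++ ts' -> normalized X t,
      q \in <<x :: ts>>%VS, q \in <<y :: ts'>>%VS &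
      (<<x :: ts>> + <<y :: ts'>>)%VS != fullv]].

Lemma exists_free_subfamily N (tau : 'I_N -> V) (us : seq V) : free us ->
  exists s : seq 'I_N, free ([seq tau i | i <- s] ++ us) /\
    forall i, tau i \in <<[seq tau i | i <- s] ++ us>>%VS.
Proof.
move=> fus.
pose ok a := `[< exists s : seq 'I_N, size s = a /\ free ([seq tau i | i <- s] ++ us) >].
have ok0 : exists a, ok a by exists 0%N; apply/asboolP; exists [::].
have okb a : ok a -> (a <= r.+1)%N.
  move=> /asboolP[s [<- /eqP dim_s]].
  have : (\dim <<[seq tau i | i <- s] ++ us>> <= r.+1)%N.
    by apply: leq_trans (dimvS (subvf _)) _; rewrite dim_full.
  by rewrite dim_s size_cat size_map; lia.
case: (ex_maxnP ok0 okb) => a /asboolP[s [sz fs]] amax; exists s; split=> // i.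
apply: contrapT => /negP ni.
have : ok a.+1.
  by apply/asboolP; exists (i :: s); rewrite /= sz free_cons ni fs.
by move/amax; rewrite ltnn.
Qed.

(* Complete x, y to a basis of <x, ts> + <y, ts'> by s entries of ts ++ ts'. Each
   other entry lies in a proper subspace given by these, hence takes finitely
   many values, and <x, ts> and <y, ts'> meet in dimension at most 2k - s. *)
Lemma dim_le_bad k x y : free [:: x; y] -> r = (k + k)%N ->
  dim_le (bad k x y) (@fcoords K r.+1) (k + k).
Proof.
move=> fxy rk; pose N := (k + k)%N.
pose us1 := (fun=> x) :: [seq entry i | i <- iota 0 k].
pose us2 := (fun=> y) :: [seq entry i | i <- iota k k].
pose vs (s : seq 'I_N) : seq (seq V * V -> V) :=
  [seq entry (nat_of_ord i) | i <- s] ++ [:: fun=> x; fun=> y].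
pose U w := (spans us1 w :&: spans us2 w)%VS.
pose Z (s : seq 'I_N) : set (seq V * V) := [set w | [/\ size w.1 = N,
  forall t, t \in w.1 -> normalized X t,
  forall i : 'I_N, nth 0 w.1 i \in spans (vs s) w,
  w.2 \in U w & (\dim (U w) <= N - size s)%N /\ (size s + 2 <= r)%N]].
have dimZ s : dim_le (Z s) (set0 `|` all_coords [seq entry i | i <- map val s]
    `|` all_coords [seq entry i | i <- iota 0 N] `|` coords snd) N.
  have [szs|szs] := leqP (size s + 2) r; last first.
    by apply: dim_le_sub (@dim_le0 K _ _ N) => w [_ _ _ _ []]; lia.
  apply: (@dim_le_leq _ _ _ _ (size s + (N - size s))).
    by move: szs; rewrite rk /N; lia.
  set G := set0 `|` all_coords _; set G' := G `|` _.
  apply: (@dim_le_subspace _ _ _ _ _ _ _ U).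
  - have algE m j : (m + k <= N)%N -> forall z : V,
        forall u, List.In u ((fun=> z) :: [seq entry i | i <- iota m k]) ->
        alg G' (fun w => u w 0 j).
      move=> mk z u [<-|/entries_In[i]]; first exact: alg_const.
      rewrite mem_iota => h ->; apply: all_coords_alg; apply: In_entries; lia.
    apply: (@constr_ext _ _ _ (fun x : (seq V * V) * V =>
      x.2 \in spans us1 x.1 /\ x.2 \in spans us2 x.1)).
      by move=> w; rewrite /U memv_cap; split=> [[-> ->]|/andP[]].
    by apply: ConstrAnd; apply: constr_spans_snd => u us j; apply: algE us;
      rewrite /N; lia.
  - by move=> w [_ _ _ ? [? _]].
  apply: (@dim_le_curves_span _ _ _ r_gt0 finX closedX _ _ _ _ (vs s)).
  - by rewrite /vs size_cat size_map.
  - move=> u; rewrite /vs List.in_app_iff => -[us j|[<-|[<-|//]] j];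
      try exact: alg_const.
    by apply: all_coords_alg; move: us; rewrite -map_comp.
  - move=> t /entries_In[i]; rewrite mem_iota add0n => /= iN -> w [sz nt ns _ _].
    split; first by apply/nt/mem_nth; rewrite sz.
    exact: (ns (Ordinal iN)).
  have := @dim_le_curves _ _ _ r_gt0 finX closedX _ (Z s) set0 0
    [seq entry i | i <- map val s].
  rewrite !size_map; apply=> [t /entries_In[i /mapP[i' _ ->] -> w [sz nt _ _ _]]|].
    by apply/nt/mem_nth; rewrite sz ltn_ord.
  exact: dim_le_set0.
have dimY s : dim_le [set q | exists ts, Z s (ts, q)] (@fcoords K r.+1) N.
  by apply: dim_le_pullback (dimZ s).
(* The union over [s] is finite because the size of a free subfamily is bounded. *)
apply: (@dim_le_sub _ _ [set q | exists a : 'I_r.+1, exists s : a.-tuple 'I_N,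
    exists ts, Z s (ts, q)]); last first.
  by apply: dim_le_bigcup => a; apply: dim_le_bigcup => s; apply: dimY.
move=> q [ts [ts' [[sz sz'] nts qx qy nfull]]].
pose w := (ts ++ ts', q).
have us1E : spans us1 w = <<x :: ts>>%VS.
  rewrite /spans /= -map_comp; congr <<_ :: _>>%VS.
  rewrite -[RHS]take_size -[RHS](map_nth_iota0 0) // sz.
  apply/eq_in_map => i; rewrite mem_iota /= => ik.
  by rewrite /entry /= nth_cat sz ifT.
have us2E : spans us2 w = <<y :: ts'>>%VS.
  rewrite /spans /= -map_comp; congr <<_ :: _>>%VS.
  rewrite -[RHS]take_size -[RHS](map_nth_iota0 0) // sz'.
  rewrite -{1}[k]addn0 iotaDl -map_comp.
  apply/eq_in_map => i; rewrite mem_iota /= => ik.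
  by rewrite /entry /= nth_cat sz ifF ?addKn //; lia.
have [s [fs hs]] := exists_free_subfamily (fun i : 'I_N => entry i w) fxy.
have vsE : spans (vs s) w = <<[seq entry (nat_of_ord i) w | i <- s] ++ [:: x; y]>>%VS.
  by rewrite /spans /vs map_cat -map_comp.
have sub : (<<[seq entry (nat_of_ord i) w | i <- s] ++ [:: x; y]>> <=
    <<x :: ts>> + <<y :: ts'>>)%VS.
  apply/span_subvP => v; rewrite mem_cat => /orP[/mapP[i _ ->]|].
    rewrite /entry /= nth_cat; case: ifP => h.
      rewrite memvE; apply: subv_trans (addvSl _ _); rewrite -memvE.
      by apply: memv_span; rewrite inE mem_nth ?orbT.
    rewrite memvE; apply: subv_trans (addvSr _ _); rewrite -memvE.
    apply: memv_span; rewrite inE mem_nth ?orbT //.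
    by move: (ltn_ord i) h; rewrite /N sz sz'; lia.
  rewrite !inE => /orP[] /eqP ->; rewrite memvE.
    by apply: subv_trans (addvSl _ _); rewrite -memvE memv_span ?mem_head.
  by apply: subv_trans (addvSr _ _); rewrite -memvE memv_span ?mem_head.
have dim1 : (size s + 2 <= \dim (<<x :: ts>> + <<y :: ts'>>))%N.
  by have := dimvS sub; rewrite (eqP fs) size_cat size_map.
have dim2 := leq_ltn_trans dim1 (dim_lt_full nfull).
have szs : (size s < r.+1)%N by lia.
exists (Ordinal szs), (in_tuple s), (ts ++ ts'); split=> //.
- by rewrite /= size_cat sz sz'.
- by move=> i; rewrite vsE; apply: hs.
- by rewrite /U us1E us2E memv_cap qx qy.
split; last by rewrite /=; lia.
rewrite /U us1E us2E /=.
have arith a b c d : (c + d = a + b)%N -> (a <= k.+1)%N -> (b <= k.+1)%N ->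
    (size s + 2 <= c)%N -> (d <= N - size s)%N by rewrite /N; lia.
apply: arith (dimv_sum_cap _ _) _ _ dim1.
  by have := dim_span (x :: ts); rewrite /= sz.
by have := dim_span (y :: ts'); rewrite /= sz'.
Qed.

End SumsAndPairs.

(** * Density of secant spaces *)

Section Density.
Variables (K : closedFieldType) (n : nat).
Local Notation V := 'rV[K]_n.
Local Notation G := (@fcoords K n).
Implicit Types (W Z : set V).

Definition dense W := closure_sub setT W G.

Lemma alg_line p (a b : V) : alg G p ->
  exists P : {poly K}, forall t, P.[t] = p (a + t *: b).
Proof.
case=> d; elim=> {d p}.
- by move=> _ c; exists c%:P => t; rewrite hornerC.
- move=> _ _ [j ->]; exists ((a 0 j)%:P + b 0 j *: 'X) => t.
  by rewrite hornerD hornerC hornerZ hornerX !mxE mulrC.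
- by move=> _ p q _ [P hP] _ [Q hQ]; exists (P + Q) => t; rewrite hornerD hP hQ.
- by move=> _ _ p q _ [P hP] _ [Q hQ]; exists (P * Q) => t; rewrite hornerM hP hQ.
Qed.

Lemma alg_affine p (a : V) c : alg G p -> alg G (fun v => p (a + c *: v)).
Proof.
apply: (alg_comp (f := fun v => a + c *: v)) => _ [j ->].
apply: (@alg_ext _ _ _ (fun v : V => a 0 j + c * v 0 j)) => [v|]; first by rewrite /= !mxE.
by apply: alg_add; [|apply: alg_mul]; try exact: alg_const; apply: alg_gen; exists j.
Qed.

(** On the line through a point where [p] is nonzero and one where [q] is nonzero, both become
    nonzero polynomials in [t], so their product is nonzero for some [t]. *)
Lemma prime_convex W : W !=set0 ->
  (forall u v t, W u -> W v -> W (u + t *: (v - u))) -> prime_set W G.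
Proof.
move=> W0 cW; split=> // p q ap aq pq; apply: contrapT => /not_orP[].
move=> /existsNP[u /not_implyP[Wu pu]] /existsNP[v /not_implyP[Wv qv]].
have [P hP] := alg_line u (v - u) ap; have [Q hQ] := alg_line u (v - u) aq.
have P0 : P != 0.
  apply/eqP => E; apply: pu; have := hP 0.
  by rewrite E horner0 scale0r addr0.
have Q0 : Q != 0.
  apply/eqP => E; apply: qv; have := hQ 1.
  by rewrite E horner0 scale1r addrC subrK.
have [t] := poly_nonroot (mulf_neq0 P0 Q0).
by rewrite hornerM hP hQ pq ?eqxx //; apply: cW.
Qed.

Lemma prime_setT : prime_set [set: V] G.
Proof. by apply: prime_convex => //; exists 0. Qed.

Definition line (x : V) : set V := [set v | exists t, v = t *: x].

Definition sumset W Z : set V := [set w | exists u v, [/\ W u, Z v & w = u + v]].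

Lemma prime_line x : prime_set (line x) G.
Proof.
apply: prime_convex; first by exists 0, 0; rewrite scale0r.
move=> _ _ t [a ->] [b ->]; exists (a + t * (b - a)).
by rewrite scalerDl -scalerBl scalerA.
Qed.

(** The summands move one after the other: primality of [W] gives a [w] with [p (w + a')] and
    [q (w + b')] both nonzero, and primality of [Z] then applies to [p] and [q] translated by
    [w]. *)
Lemma prime_sumset W Z : prime_set W G -> prime_set Z G -> prime_set (sumset W Z) G.
Proof.
move=> [[w0 Ww0] pW] [[z0 Zz0] pZ]; split; first by exists (w0 + z0), w0, z0.
move=> p q ap aq pq; apply: contrapT => /not_orP[].
move=> /existsNP[_ /not_implyP[[a [a' [Wa Za' ->]]] pa]].
move=> /existsNP[_ /not_implyP[[b [b' [Wb Zb' ->]]] qb]].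
have tr f c : alg G f -> alg G (fun v => f (v + c)).
  move=> /(alg_affine c 1); apply: alg_ext => v /=.
  by rewrite scale1r addrC.
have [w Ww [pw qw]] : exists2 w, W w & p (w + a') <> 0 /\ q (w + b') <> 0.
  apply: contrapT => h.
  have [w Ww|/(_ a Wa)//|/(_ b Wb)//] := pW _ _ (tr p a' ap) (tr q b' aq).
  apply/eqP; rewrite mulf_eq0; apply: contrapT => /negP.
  by rewrite negb_or => /andP[/eqP h1 /eqP h2]; apply: h; exists w.
have tr' f c : alg G f -> alg G (fun v => f (c + v)).
  by move=> /(alg_affine c 1); apply: alg_ext => v /=; rewrite scale1r.
have [z Zz|/(_ a' Za')//|/(_ b' Zb')//] := pZ _ _ (tr' p w ap) (tr' q w aq).
by apply: pq; exists w, z.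
Qed.

Lemma closure_subset Z W : Z `<=` W -> closure_sub Z W G.
Proof. by move=> ZW p _ pW w /ZW /pW. Qed.

Lemma dim_le_closure Z W m : closure_sub Z W G -> dim_le W G m -> dim_le Z G m.
Proof.
move=> ZW [c hc]; exists c => d; have [I [g [cI hI]]] := hc d.
have [N [h [hG ind hsp]]] := exists_basis hI; exists 'I_N, h; split.
  apply: leq_trans cI; apply: independent_card ind _ => j; exact/hI/hG.
move=> p pd; have [a ha] := hsp p pd; exists a => w Zw.
apply/eqP; rewrite -subr_eq0; apply/eqP.
apply: (ZW (fun w => p w - \sum_i a i * h i w)) => // [|w' Ww'].
  apply: alg_sub; first by exists d.
  by apply: alg_sum => i; apply: alg_mul; [apply: alg_const|exists d].
by rewrite ha // subrr.
Qed.

(** The coordinate subspaces [F i] form a strict chain of irreducible sets, and each step costs one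
    dimension. *)
Lemma dim_full_space m : (m < n)%N -> ~ dim_le [set: V] G m.
Proof.
pose F i : set V := [set v | forall j : 'I_n, (i <= j)%N -> v 0 j = 0].
have F0 i : F i 0 by move=> j _; rewrite mxE.
have primeF i : prime_set (F i) G.
  apply: prime_convex => [|u v t Fu Fv j ij]; first by exists 0.
  by rewrite !mxE Fu // Fv // subrr mulr0 addr0.
have properF i : (i < n)%N -> proper_in (F i) (F i.+1) G.
  move=> lt_in; split; first by apply: closure_subset => v Fv j ij; apply: Fv; lia.
  pose j := Ordinal lt_in.
  move=> /(_ (fun v => v 0 j)) h.
  have : (delta_mx 0 j : V) 0 j = 0.
    apply: h => [|v /(_ j (leqnn _))//|j' ij']; first by apply: alg_gen; exists j.
    by rewrite mxE eqxx -val_eqE /= gtn_eqF.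
  by rewrite mxE !eqxx => /eqP; rewrite oner_eq0.
have key i : (i < n)%N -> ~ dim_le (F i.+1) G i.
  elim: i => [|i IH] lt_in.
    by apply: dim_le0_proper (properF 0%N lt_in) _ => //; exists 0.
  move=> /(dim_le_proper (primeF _) (properF _ lt_in)); apply: IH; lia.
move=> mn /(@dim_le_sub _ _ _ (F m.+1)) h; apply: (key m mn); exact: h.
Qed.

Lemma not_dense W m : (m < n)%N -> dim_le W G m -> ~ dense W.
Proof. by move=> mn dW /dim_le_closure/(_ dW)/(dim_full_space mn). Qed.

Lemma not_dense_witness W : ~ dense W ->
  exists g, [/\ alg G g, exists v, g v <> 0 & forall v, W v -> g v = 0].
Proof.
move=> nd; apply: contrapT => h; apply: nd => p ap pW v _.
by apply: contrapT => pv; apply: h; exists p; split=> //; exists v.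
Qed.

Lemma generic_nonzero (s : seq (V -> K)) : (forall p, List.In p s -> alg G p) ->
  exists g, [/\ alg G g, exists v, g v <> 0 & forall v, g v <> 0 ->
    forall p, List.In p s -> p v = 0 -> forall u, p u = 0].
Proof.
elim: s => [|p s IH] algs.
  exists (fun=> 1); split=> //; first exact: alg_const.
  by exists 0; apply/eqP; apply: oner_neq0.
have [g [ag [v gv] hg]] := IH (fun p h => algs p (or_intror h)).
have ap := algs p (or_introl erefl).
have [p0|/existsNP[u pu]] := pselect (forall u, p u = 0).
  exists g; split=> // [|w gw q [<-|] //]; first by exists v.
  exact: hg.
exists (fun v => g v * p v); split; first exact: alg_mul.
  apply: contrapT => h.
  have [w _|/(_ v I)//|/(_ u I)//] := prime_setT.2 _ _ ag ap.
  by apply: contrapT => h'; apply: h; exists w.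
move=> w /eqP; rewrite mulf_eq0 negb_or => /andP[/eqP gw /eqP pw] q [<- //|].
exact: hg.
Qed.

(** [g] is the product of the polynomials of the pattern that are not identically zero. All points
    with [g <> 0] share one pattern, and density puts a point of [P] among them. *)
Lemma constr_dense_open (P : V -> Prop) : constr G P -> dense P ->
  exists g, [/\ alg G g, exists v, g v <> 0 & forall v, g v <> 0 -> P v].
Proof.
move=> /constr_pattern[ps [/generic_nonzero[g [ag [v gv] hg]] hP]] dP.
exists g; split=> // [|w gw]; first by exists v.
have [u Pu gu] : exists2 u, P u & g u <> 0.
  apply: contrapT => h; apply: gv; apply: dP => // u Pu.
  by apply: contrapT => gu; apply: h; exists u.
by apply: hP Pu => p psp; split=> p0; [apply: hg p0 _|apply: hg p0 _].
Qed.

End Density.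

(** * The strict chain of sums *)

Section SecantsFill.
Variables (K : closedFieldType) (r : nat) (X : set (pspace K r)).
Local Notation V := 'rV[K]_r.+1.
Local Notation G := (@fcoords K r.+1).
Hypothesis primeC : prime_set (cone X) G.
Hypothesis ndC : forall H : {vspace V}, H != fullv -> ~ cone X `<=` [set v | v \in H].

Definition stable (W : set V) (x : V) := closure_sub (sumset W (line x)) W G.

Lemma cone_spans : exists2 vs : seq V, (forall v, v \in vs -> cone X v) &
  <<vs>>%VS = fullv.
Proof.
pose ok a := `[< exists vs : seq V, (forall v, v \in vs -> cone X v) /\
  \dim <<vs>> = a >].
have ok0 : exists a, ok a.
  by exists (\dim <<[::] : seq V>>); apply/asboolP; exists [::].
have okb a : ok a -> (a <= r.+1)%N.
  move=> /asboolP[vs [_ <-]].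
  by apply: leq_trans (dimvS (subvf _)) _; rewrite dim_full.
case: (ex_maxnP ok0 okb) => a /asboolP[vs [vsC da]] amax; exists vs => //.
apply/eqP/negPn/negP => /ndC; apply => v Cv /=.
apply: contrapT => /negP nv.
have : ok (\dim <<v :: vs>>).
  apply/asboolP; exists (v :: vs); split=> // u.
  by rewrite inE => /orP[/eqP->//|/vsC].
move/amax; rewrite -da leqNgt => /negP; apply.
rewrite span_cons ltn_neqAle dimvS ?addvSr // andbT.
apply: contra nv => /eqP E.
have -> : <<vs>>%VS = (<[v]> + <<vs>>)%VS by apply/eqP; rewrite eqEdim addvSr E /=.
by rewrite memvE addvSl.
Qed.

(** The cone spans [V], so every vector is reached from [w0] by finitely many translations along
    stabilizing directions. The induction translates the equation [p] instead of the set. *)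
Lemma stable_dense W : W !=set0 -> (forall x, cone X x -> stable W x) -> dense W.
Proof.
move=> [w0 Ww0] stW p ap pW v _.
have [vs vsC vsE] := cone_spans.
rewrite -[v](subrK w0) addrC.
have : v - w0 \in <<vs>>%VS by rewrite vsE memvf.
move: (v - w0); elim: vs {vsE} vsC p ap pW => [|x vs IH] vsC p ap pW u.
  by rewrite span_nil memv0 => /eqP->; rewrite addr0 pW.
rewrite span_cons => /memv_addP[_ /vlineP[c ->] [z zvs ->]].
rewrite addrA addrAC.
have ap' : alg G (fun v => p (v + c *: x)).
  by apply: alg_ext (alg_affine (c *: x) 1 ap) => v'; rewrite scale1r addrC.
apply: (IH _ _ ap') => // [y h|w Ww]; first by apply: vsC; rewrite inE h orbT.
apply: (stW x (vsC x (mem_head _ _)) p ap pW).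
by exists w, (c *: x); split=> //; exists c.
Qed.

Lemma not_stableP W x : ~ stable W x -> exists p w t,
  [/\ alg G p, forall v, W v -> p v = 0, W w & p (w + t *: x) <> 0].
Proof.
move=> nst; apply: contrapT => h; apply: nst => p ap pW _ [w [_ [Ww [t ->] ->]]].
by apply: contrapT => pt; apply: h; exists p, w, t.
Qed.

(** With a witness [p], [w], [t] fixed, [p (w + t *: x) <> 0] is an open condition on [x], and two
    non-empty open subsets of the irreducible cone meet. *)
Lemma not_stable_and W W' x x' : cone X x -> cone X x' ->
  ~ stable W x -> ~ stable W' x' ->
  exists2 y, cone X y & ~ stable W y /\ ~ stable W' y.
Proof.
move=> Cx Cx' /not_stableP[p [w [t [ap pW Ww pt]]]].
move=> /not_stableP[p' [w' [t' [ap' pW' Ww' pt']]]].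
apply: contrapT => h.
have [y Cy|/(_ x Cx)//|/(_ x' Cx')//] :=
  primeC.2 _ _ (alg_affine w t ap) (alg_affine w' t' ap').
apply/eqP; rewrite mulf_eq0; apply: contrapT => /negP.
rewrite negb_or => /andP[/eqP h1 /eqP h2]; apply: h; exists y => //; split=> st.
  by apply: h1; apply: st => //; exists w, (t *: y); split=> //; exists t.
by apply: h2; apply: st => //; exists w', (t' *: y); split=> //; exists t'.
Qed.

Lemma sums0 k : sums X k 0.
Proof. by elim: k => [//|k IH] /=; exists 0; [left|rewrite subr0]. Qed.

Lemma sumsS k : sums X k.+1 = sumset (sums X k) (cone X).
Proof.
apply/seteqP; split=> [q [v Cv hq]|_ [u [v [hu Cv ->]]]].
  by exists (q - v), v; rewrite subrK.
by exists v => //; rewrite addrK.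
Qed.

Lemma prime_sums k : prime_set (sums X k) G.
Proof.
elim: k => [|k IH]; last by rewrite sumsS; apply: prime_sumset.
by apply: prime_convex => [|_ _ t -> ->]; [exists 0|rewrite subrr scaler0 addr0].
Qed.

Lemma sub_sumset_line (W : set V) x : W `<=` sumset W (line x).
Proof. by move=> w Ww; exists w, 0; rewrite addr0; split=> //; exists 0; rewrite scale0r. Qed.

Lemma sums_line_sub k x : cone X x -> sumset (sums X k) (line x) `<=` sums X k.+1.
Proof.
by move=> Cx _ [u [_ [hu [t ->] ->]]]; rewrite sumsS; exists u, (t *: x);
  split=> //; apply: coneZ.
Qed.

Lemma dense_sumsS k : dense (sums X k) -> dense (sums X k.+1).
Proof.
move=> dk p ap pW; apply: dk ap _ => v hv; apply: pW.
by exists 0; [left|rewrite subr0].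
Qed.

(* If the closure of sums j + Kx were that of sums j.+1 for all x not stabilizing
   sums j, then the whole cone would stabilize sums j.+1, since stabilizing is a
   closed condition on x and the cone is irreducible. *)
Lemma strict_step j : ~ dense (sums X j.+1) -> exists2 x, cone X x &
  ~ stable (sums X j) x /\ ~ closure_sub (sums X j.+1) (sumset (sums X j) (line x)) G.
Proof.
move=> ndW; have W0 k : sums X k !=set0 by exists 0; apply: sums0.
have [x Cx nx] : exists2 x, cone X x & ~ stable (sums X j.+1) x.
  apply: contrapT => h; apply: ndW; apply: stable_dense => // x Cx.
  by apply: contrapT => nx; apply: h; exists x.
have [x' Cx' nx'] : exists2 x, cone X x & ~ stable (sums X j) x.
  apply: contrapT => h; apply: ndW; apply: dense_sumsS.
  apply: stable_dense => // y Cy.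
  by apply: contrapT => ny; apply: h; exists y.
have [y Cy [ny ny']] := not_stable_and Cx Cx' nx nx'.
exists y => //; split=> // cl; apply: ny => p ap pW _ [w [_ [Ww [t ->] ->]]].
have ap' : alg G (fun v => p (v + t *: y)).
  by apply: alg_ext (alg_affine (t *: y) 1 ap) => v'; rewrite scale1r addrC.
apply: (cl _ ap') Ww => _ [u [_ [hu [c ->] ->]]]; apply: pW.
by apply: (sums_line_sub Cy); exists u, ((c + t) *: y);
  split=> //; [exists (c + t)|rewrite scalerDl addrA].
Qed.

Lemma proper_sums_line W x : ~ stable W x -> proper_in W (sumset W (line x)) G.
Proof. by move=> nst; split=> //; apply/closure_subset/sub_sumset_line. Qed.

(** Each summand contributes two dimensions: up to closure, [sums j + K x] lies strictly between
    [sums j] and [sums j.+1]. The induction starts with 0, [K x] and the cone. *)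
Lemma sums_dim_ge j : ~ dense (sums X j.+1) -> ~ dim_le (sums X j.+1) G (j + j).+1.
Proof.
elim: j => [|j IH] nd; have [x Cx [nst ncl]] := strict_step nd;
  move=> /(dim_le_proper (prime_sums _)) h;
  have {}h := h _ (conj (closure_subset (sums_line_sub Cx)) ncl).
  apply: dim_le0_proper (proper_sums_line nst) _ h; last by exists 0.
  by apply: prime_sumset (prime_line x); apply: prime_sums.
rewrite addnS in h.
have pr : prime_set (sumset (sums X j.+1) (line x)) G.
  by apply: prime_sumset (prime_line x); apply: prime_sums.
have := dim_le_proper pr (proper_sums_line nst) h; apply: IH => dn.
by apply: nd; apply: dense_sumsS.
Qed.

(** [sums k] has dimension at least [2k]; the strict inclusion into its sum with the line already
    reaches [dim V = 2k + 1] and leaves no room for another one. *)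
Lemma sums_line_dense k x : (0 < k)%N -> r = (k + k)%N -> ~ dense (sums X k) ->
  ~ stable (sums X k) x -> dense (sumset (sums X k) (line x)).
Proof.
case: k => // k _ rk nd nst; apply: contrapT => nd'.
apply: (sums_dim_ge nd).
have dV : dim_le [set: V] G (k.+1 + k.+1).+1.
  by rewrite -rk; apply: dim_le_coords.
have := dim_le_proper (prime_setT _ _) (conj (closure_subset (@subsetT _ _)) nd') dV.
rewrite addnS => /dim_le_proper; apply; last exact: proper_sums_line.
by apply: prime_sumset (prime_line x); apply: prime_sums.
Qed.

Lemma constr_sums k : zariski_closed X -> constr G (sums X k).
Proof.
move=> cX; have cV (j : 'I_r.+1) : alg (ext (n := r.+1) G) (fun x : V * V => x.1 0 j).
  by apply: alg_gen; left; exists (fun v : V => v 0 j) => //; exists j.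
elim: k => [|k IH].
  apply: constr_eq_row => j; first by apply: alg_gen; exists j.
  by apply: (@alg_ext _ _ _ (fun=> 0)) => [v|]; [rewrite mxE|apply: alg_const].
apply: (@constr_ext _ _ _ (fun q => exists v, cone X v /\ sums X k (q - v))).
  by move=> q; split=> [[v []]|[v]]; exists v.
apply: (@constr_proj _ _ _ _ (fun x : V * V => cone X x.2 /\ sums X k (x.1 - x.2))).
apply: ConstrAnd.
  by apply: (constr_comp (f := snd)) (cone_constr cX) => _ [j ->]; apply: coords_ext.
apply: (constr_comp (f := fun x : V * V => x.1 - x.2)) IH => _ [j ->].
apply: (@alg_ext _ _ _ (fun x : V * V => x.1 0 j - x.2 0 j)) => [x|].
  by rewrite /= !mxE.
by apply: alg_sub => //; apply: coords_ext.
Qed.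

Lemma constr_sums_line k x : zariski_closed X ->
  constr G (sumset (sums X k) (line x)).
Proof.
move=> cX.
apply: (@constr_ext _ _ _ (fun q => exists l : 'rV[K]_1, sums X k (q - l 0 0 *: x))).
  move=> q; split=> [[l h]|[u [_ [hu [t ->] ->]]]].
    by exists (q - l 0 0 *: x), (l 0 0 *: x); rewrite subrK; split=> //; exists (l 0 0).
  by exists (const_mx t); rewrite mxE addrK.
apply: (@constr_proj _ _ _ _ (fun z : V * 'rV[K]_1 => sums X k (z.1 - z.2 0 0 *: x))).
apply: (constr_comp (f := fun z : V * 'rV[K]_1 => z.1 - z.2 0 0 *: x))
  (constr_sums k cX) => _ [j ->].
apply: (@alg_ext _ _ _ (fun z : V * 'rV[K]_1 => z.1 0 j - z.2 0 0 * x 0 j)) => [z|].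
  by rewrite /= !mxE.
apply: alg_sub.
  by apply: alg_gen; left; exists (fun v : V => v 0 j) => //; exists j.
by apply: alg_mul; [apply: coords_ext|apply: alg_const].
Qed.

End SecantsFill.

(** * Generic points *)

Section PointSets.
Variables (K : closedFieldType) (r : nat) (X : set (pspace K r)).
Local Notation V := 'rV[K]_r.+1.
Local Notation P := (pspace K r).

Lemma pspan_span (vs : seq V) (S : {fset P}) :
  (forall p, p \in S -> exists2 v, v \in vs & val p = <[v]>%VS) ->
  forall q, pspan [set` S] q -> (val q <= <<vs>>)%VS.
Proof.
move=> Svs q; apply => p /= /Svs[v vvs pE]; rewrite /plin /= pE.
by rewrite -memvE memv_span.
Qed.

Lemma span_pspan (vs : seq V) (S : {fset P}) q :
  (forall v, v \in vs -> exists2 p, p \in S & v \in val p) ->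
  (val q <= <<vs>>)%VS -> pspan [set` S] q.
Proof.
move=> vsS qvs U SU; apply: subv_trans qvs _; apply/span_subvP => v /vsS[p pS vp].
exact: subvP (SU p pS) v vp.
Qed.

Lemma spanning_set_sums q S w : spanning_set X q S -> w \in val q ->
  sums X #|` S| w.
Proof.
move=> [SX qS] wq; pose vs := [seq vpick (val p) | p <- S].
have -> : #|` S| = size vs by rewrite /vs size_map.
apply: span_sums => [_ /mapP[p pS ->]|].
  by right; exists p; [apply: SX|apply: memv_pick].
have /subvP : (val q <= <<vs>>)%VS; last by apply.
apply: (pspan_span (S := S)) qS => p pS; exists (vpick (val p)).
  exact: map_f.
have [v v0 pE] := pointP p; apply/eqP; rewrite eq_sym eqEdim.
by rewrite -memvE memv_pick dim_vline vpick0 pE -dimv_eq0 !dim_vline v0.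
Qed.

(** Only an inequality of cardinals, since different vectors may represent the same point; equality
    will come from the lower bound on the rank. *)
Lemma spanning_set_of_seq q (vs : seq V) :
  (forall v, v \in vs -> cone X v /\ v != 0) -> (val q <= <<vs>>)%VS ->
  exists S, [/\ spanning_set X q S, (#|` S| <= size vs)%N &
    forall p, pspan [set` S] p -> (val p <= <<vs>>)%VS].
Proof.
move=> vsX qvs.
(* The default [q] is taken only at the zero vector, which [vsX] excludes from [vs]. *)
pose pt v : P := if insub <[v]>%VS is Some p then p else q.
have ptE v : v != 0 -> val (pt v) = <[v]>%VS.
  by move=> v0; rewrite /pt insubT ?dim_vline ?v0.
exists (seq_fset tt [seq pt v | v <- vs]); split.
- split=> [p pS|].
    have /mapP[v /vsX[Cv v0] ->] : p \in [seq pt v | v <- vs].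
      by rewrite -(seq_fsetE tt).
    rewrite (_ : pt v = point_of v0); first exact: cone_point.
    exact/val_inj/ptE.
  apply: span_pspan qvs => v vvs; exists (pt v); first by rewrite seq_fsetE map_f.
  by have [_ v0] := vsX v vvs; rewrite ptE // memv_line.
- by rewrite -[size vs](size_map pt) size_seq_fset size_undup.
- apply: pspan_span => p; rewrite seq_fsetE => /mapP[v vvs ->]; exists v => //.
  by apply: ptE; have [] := vsX v vvs.
Qed.

End PointSets.

Lemma normalized_neq0 (K : closedFieldType) r (X : set (pspace K r)) v :
  normalized X v -> v != 0.
Proof.
by move=> [_ [i vi]]; apply/eqP => E; move/eqP: vi; rewrite E mxE eq_sym oner_eq0.
Qed.

Section GenericPoint.
Variables (K : closedFieldType) (r k : nat) (X : set (pspace K r)).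
Local Notation V := 'rV[K]_r.+1.
Local Notation P := (pspace K r).
Hypothesis rk : r = (k + k)%N.
Hypothesis X0 : X !=set0.

Lemma line_span_seq x w : sumset (sums X k) (line x) w -> exists ts : seq V,
  [/\ size ts = k, forall t, t \in ts -> normalized X t & w \in <<x :: ts>>%VS].
Proof.
move=> [s [_ [/(sums_normalized X0)[ts [sz nts sts]] [c ->] ->]]]; exists ts.
by split=> //; rewrite span_cons addrC memv_add // memvZ // memv_line.
Qed.

Lemma generic_point x y q w : x != 0 -> y != 0 -> cone X x -> cone X y ->
  val q = <[w]>%VS -> ~ sums X k w -> ~ bad X k x y w ->
  sumset (sums X k) (line x) w -> sumset (sums X k) (line y) w ->
  Xrank X q = k.+1 /\ [set q] = \bigcap_(S in solutions X q) pspan [set` S].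
Proof.
move=> x0 y0 Cx Cy qw nw nbad /line_span_seq[ts [sz nts wts]].
move=> /line_span_seq[ts' [sz' nts' wts']].
have w0 : w != 0.
  by have := valP q; rewrite /= qw dim_vline; case: (w != 0).
have vsX z s : cone X z -> z != 0 -> (forall t, t \in s -> normalized X t) ->
    forall v, v \in z :: s -> cone X v /\ v != 0.
  move=> Cz z0 ns v; rewrite inE => /orP[/eqP-> //|/ns nv].
  by split; [case: nv|apply: normalized_neq0 nv].
have qS : (val q <= <<x :: ts>>)%VS by rewrite qw -memvE.
have qS' : (val q <= <<y :: ts'>>)%VS by rewrite qw -memvE.
have [S [spS szS subS]] := spanning_set_of_seq (vsX _ _ Cx x0 nts) qS.
have [S' [spS' szS' subS']] := spanning_set_of_seq (vsX _ _ Cy y0 nts') qS'.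
have wq : w \in val q by rewrite qw memv_line.
have lower T : spanning_set X q T -> (k.+1 <= #|` T|)%N.
  move=> /spanning_set_sums/(_ wq) hT; rewrite ltnNge; apply/negP => Tk.
  exact: nw (sums_mono Tk hT).
have cardS : #|` S| = k.+1.
  by apply/eqP; rewrite eqn_leq lower // andbT; move: szS; rewrite /= sz.
have cardS' : #|` S'| = k.+1.
  by apply/eqP; rewrite eqn_leq lower // andbT; move: szS'; rewrite /= sz'.
have rank : is_Xrank X q k.+1 by split=> //; exists S.
have XrankE : Xrank X q = k.+1.
  rewrite /Xrank; case: xgetP => [m -> [[T spT <-] minT]|/(_ k.+1)//].
  by apply/eqP; rewrite eqn_leq lower // andbT -cardS minT.
split=> //; apply/seteqP; split=> [_ -> T [[_ qT] _] //|p hp].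
apply: point_eq.
have solS : solutions X q S by split=> //; rewrite XrankE.
have solS' : solutions X q S' by split=> //; rewrite XrankE.
have pcap : (val p <= <<x :: ts>> :&: <<y :: ts'>>)%VS.
  by rewrite subv_cap subS ?subS' //; apply: hp.
apply: subv_trans pcap _.
have full : (<<x :: ts>> + <<y :: ts'>>)%VS = fullv.
  apply/eqP/negPn/negP => nf; apply: nbad; exists ts, ts'; split=> //.
  by move=> t; rewrite mem_cat => /orP[/nts|/nts'].
suff -> : (<<x :: ts>> :&: <<y :: ts'>>)%VS = val q by [].
apply/esym/eqP; rewrite eqEdim subv_cap qS qS' qw dim_vline w0 /=.
have arith a b c d : (c + d = a + b)%N -> (a <= k.+1)%N -> (b <= k.+1)%N ->
    (c = r.+1)%N -> (d <= 1)%N by clear -rk; lia.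
apply: arith (dimv_sum_cap _ _) _ _ _; last by rewrite full dim_full.
  by have := dim_span (x :: ts); rewrite /= sz.
by have := dim_span (y :: ts'); rewrite /= sz'.
Qed.

End GenericPoint.

Theorem theorem1 (K : closedFieldType) (r : nat) (r_ge2 : (2 <= r)%N)
    (r_even : ~~ odd r) (X : set (pspace K r)) (X_curve : integral_curve X)
    (X_nondeg : nondegenerate_set X) :
  exists U : set (pspace K r),
    [/\ zariski_open U,
        U !=set0,
        forall q, U q -> Xrank X q = (r %/ 2 + 1)%N,
        forall q, U q ->
          [set q] = \bigcap_(S in solutions X q) pspan [set` S] &
        forall q q' : pspace K r, U q ->
          solutions X q' = solutions X q -> q' = q].
Proof.
have [closedX irrX _] := X_curve.
have X0 : X !=set0 by case: irrX.
pose k := (r %/ 2)%N.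
have rk : r = (k + k)%N by rewrite /k divn2 addnn even_halfK.
have k0 : (0 < k)%N by lia.
have r0 : (0 < r)%N by lia.
have finX H := @curve_section_finite _ _ X H X_curve X_nondeg.
have primeC := cone_prime irrX.
have ndC (H : {vspace 'rV[K]_r.+1}) : H != fullv ->
    ~ cone X `<=` [set v | v \in H].
  move=> /proper_sub_hyperplane[H' HH' dH'] CH; apply: (X_nondeg H' dH') => p Xp.
  apply/subvP => v vp; apply: (subvP HH'); apply: CH.
  by right; exists p.
have nd : ~ dense (sums X k).
  apply: (@not_dense _ _ _ (k + k)); first by rewrite -rk.
  exact: dim_le_sums.
have sums_neq0 : sums X k !=set0 by exists 0%R; apply: sums0.
have [x Cx nx] : exists2 x, cone X x & ~ stable (sums X k) x.
  apply: contrapT => h; apply: nd; apply: (stable_dense ndC) => // x Cx.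
  by apply: contrapT => nx; apply: h; exists x.
have stable_neq0 z : ~ stable (sums X k) z -> z != 0%R.
  move=> nz; apply/eqP => E; apply: nz; apply: closure_subset.
  by move=> _ [u [_ [hu [t ->] ->]]]; rewrite E GRing.scaler0 GRing.addr0.
(* Both requirements on [y] are made open: [p (w + t *: y) <> 0], and the non-vanishing of a linear
   form that is zero at [x] but not on the whole cone. Irreducibility of the cone makes them
   compatible. *)
have [y Cy [ny yx]] : exists2 y, cone X y & ~ stable (sums X k) y /\ y \notin <[x]>%VS.
  have /ndC/existsNP[v /not_implyP[Cv /= nv]] : <[x]>%VS != fullv.
    apply/eqP => E; have := dim_vline x; rewrite E dim_full.
    by case: (x != 0%R) => /=; lia.
  have [a ha] := vspace_equations <[x]>%VS.
  have [j aj] : exists j, (\sum_i a j i * v 0 i)%R <> 0%R.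
    by apply: contrapT => h; apply: nv; apply/ha => j; apply: contrapT => aj;
      apply: h; exists j.
  have [p [w [t [ap pW Ww pt]]]] := not_stableP nx.
  have al : alg (@fcoords K r.+1) (fun v => \sum_i a j i * v 0 i)%R.
    apply: alg_sum => i; apply: alg_mul; first exact: alg_const.
    by apply: alg_gen; exists i.
  apply: contrapT => h.
  have [y Cy|/(_ x Cx)//|/(_ v Cv)//] := primeC.2 _ _ (alg_affine w t ap) al.
  apply/eqP; rewrite GRing.mulf_eq0; apply: contrapT => /negP.
  rewrite negb_or => /andP[/eqP h1 /eqP h2]; apply: h; exists y => //; split.
    by move=> st; apply: h1; apply: st => //; exists w, (t *: y)%R; split=> //; exists t.
  by apply/negP => /ha/(_ j).
have fyx : free [:: y; x].
  by rewrite free_cons seq1_free stable_neq0 // span_seq1 yx.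
have line_open z : ~ stable (sums X k) z -> cone X z ->
    exists g, [/\ alg (@fcoords K r.+1) g, exists v, g v <> 0%R &
      forall v, g v <> 0%R -> sumset (sums X k) (line z) v].
  move=> nz Cz; apply: constr_dense_open; first exact: constr_sums_line.
  exact: sums_line_dense.
have [g1 [ag1 [v1 nz1] hg1]] := line_open x nx Cx.
have [g2 [ag2 [v2 nz2] hg2]] := line_open y ny Cy.
have [g3 [ag3 [v3 nz3] hg3]] : exists g, [/\ alg (@fcoords K r.+1) g,
    exists v, g v <> 0%R & forall v, bad X k y x v -> g v = 0%R].
  apply: not_dense_witness; apply: (@not_dense _ _ _ (k + k)).
    by rewrite -rk.
  exact: dim_le_bad.
have [g4 [ag4 [v4 nz4] hg4]] := not_dense_witness nd.
(* [g1] and [g2] provide decompositions through [x] and [y], [g3] makes their spans fill [V], and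
   [g4] keeps the vector outside [sums k]. *)
have [g [ag [v0 gv0] hg]] : exists g, [/\ alg (@fcoords K r.+1) g,
    exists v, g v <> 0%R & forall v, g v <> 0%R ->
      [/\ g1 v <> 0%R, g2 v <> 0%R, g3 v <> 0%R & g4 v <> 0%R]].
  have [|g [ag gnz hg]] := @generic_nonzero _ _ [:: g1; g2; g3; g4].
    by move=> p /= [<-|[<-|[<-|[<-|]]]].
  exists g; split=> // v gv; split=> E.
  - by apply: nz1; apply: (hg v gv) E _; left.
  - by apply: nz2; apply: (hg v gv) E _; right; left.
  - by apply: nz3; apply: (hg v gv) E _; right; right; left.
  - by apply: nz4; apply: (hg v gv) E _; right; right; right; left.
have g_neq0 v : g v <> 0%R -> v != 0%R.
  move=> /hg[_ _ _ g4v]; apply/eqP => E; apply: g4v; apply: hg4.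
  by rewrite E; apply: sums0.
have [d [f [hf fv0 fg]]] := homog_component ag (introN eqP gv0).
pose U : set (pspace K r) := [set p | ~ vanishes_at f p].
have good q : U q -> Xrank X q = k.+1 /\
    [set q] = \bigcap_(S in solutions X q) pspan [set` S].
  move=> /vanishesPn[u uq /eqP fu].
  have [P P0 hP] := fg u fu.
  (* Although [g] may vanish at the representative [u], some multiple of [u] avoids its zeros; the
     generic conditions apply to that vector. *)
  have [t] := poly_nonroot (GRing.mulf_neq0 P0 (negbT (polyX_eq0 K))).
  rewrite hornerM hornerX GRing.mulf_eq0 negb_or hP => /andP[/eqP gt t0].
  set w := (t *: u)%R in gt.
  have [h1 h2 h3 h4] := hg w gt.
  have qw : val q = <[w]>%VS.
    apply/esym/eqP; rewrite eqEdim -memvE memvZ //= dim_vline (g_neq0 _ gt).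
    by rewrite (eqP (valP q)).
  apply: (generic_point rk X0 (stable_neq0 _ ny) (stable_neq0 _ nx) Cy Cx qw).
  - by move=> /hg4.
  - by move=> /hg3.
  - exact: hg2.
  - exact: hg1.
exists U; split.
- exists [set f]; split; first by move=> _ ->; exists d.
  rewrite /U; apply/seteqP; split=> [p /contrapT h _ ->//|p h /=].
  by apply; apply: h.
- exists (point_of (g_neq0 _ gv0)) => h; move/eqP: fv0; apply; apply: h.
  exact: memv_line.
- by move=> q /good[-> _]; rewrite addn1.
- by move=> q /good[].
- move=> q q' /good[_ E] Sqq'.
  suff : [set q] q' by [].
  by rewrite E => S; rewrite -Sqq' => -[[]].
Qed.
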